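(* For $\varepsilon>0$ let $\widetilde P^\varepsilon$ be the law on $C(\mathbb R_+,C)$ of the process $(W_t)_{t\ge0}=((|X_t|^2,|X_t|_{-1}^2))_{t\ge0}$ under $\widetilde{\mathbb P}^\varepsilon$. Then the family $\{\widetilde P^\varepsilon:\varepsilon>0\}$ is tight.
   Context: Let $n\ge4$, $N=2n$, and let $1=\lambda_1=\lambda_2<\lambda_3=\lambda_4<\dots<\lambda_{N-1}=\lambda_N$ be reals. On $\mathbb R^N$ put $\langle x,y\rangle=\sum_\ell x_\ell y_\ell$, $|x|^2=\sum_\ell x_\ell^2$, $\langle x,y\rangle_{-1}=\sum_\ell x_\ell y_\ell/\lambda_\ell$, $|x|_{-1}^2=\sum_\ell x_\ell^2/\lambda_\ell$. Fix $a>0$, $\delta_1,\dots,\delta_N\in(-1,0]$ with $\delta_{2i}=\delta_{2i-1}$, and $\widetilde L=\sum_\ell\lambda_\ell(\tfrac a2(1+\delta_\ell)\partial_\ell^2-x_\ell\partial_\ell)$. Let $b:\mathbb R^N\to\mathbb R^N$ with each $b(x)_\ell$ a quadratic form in $x$, $\operatorname{div}b=0$, $\langle x,b(x)\rangle=0=\langle x,b(x)\rangle_{-1}$; $B=\sum_\ell b(x)_\ell\partial_\ell$. Let $\mathcal J$ be the set of triples $J=(k,\ell,m)$ in $\{1,\dots,N\}$ with $\lambda_k<\lambda_\ell<\lambda_m$; $T_J=\sum x_ax_b(1/\lambda_a-1/\lambda_b)\partial_c$ (sum over the three cyclic permutations $(a,b,c)$ of $J$); $R_i=x_{2i}\partial_{2i-1}-x_{2i-1}\partial_{2i}$,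 $1\le i\le n$; enumerate these as $Z_1,\dots,Z_M$ and set $\mathcal D=\frac12\sum_m Z_m^2$. Fix $\kappa\in(0,1]$; for $\varepsilon>0$, $\widetilde{\mathcal L}^\varepsilon=\widetilde L+\varepsilon^{-1}(B+\kappa\mathcal D)$. It is known that the martingale problem for $\widetilde{\mathcal L}^\varepsilon$ on $C(\mathbb R_+,\mathbb R^N)$ (canonical process $(X_t)$) is well posed from every starting point $x$, giving laws $\widetilde{\mathbb P}^\varepsilon_x$ that form a strong Markov process with a unique stationary probability $\widetilde\mu_\varepsilon$; $\widetilde{\mathbb P}^\varepsilon=\int\widetilde\mu_\varepsilon(dx)\widetilde{\mathbb P}^\varepsilon_x$. $C=\{(u,v)\in\mathbb R^2:0\le v\le u\le\lambda_Nv\}$, and $C(\mathbb R_+,C)$ carries the topology of uniform convergence on compact intervals. *)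

(* Defs.v *)
From HB Require Import structures.
From mathcomp Require Import all_boot all_order all_algebra.
From mathcomp Require Import all_classical all_reals all_analysis.
Set Implicit Arguments. Unset Strict Implicit. Unset Printing Implicit Defensive.
Import Order.TTheory GRing.Theory Num.Theory.
Import numFieldNormedType.Exports.
Local Open Scope classical_set_scope.
Local Open Scope ring_scope.

Section Defs.
Variables (R : realType) (N : nat).

Definition xco (x : 'rV[R]_N) (l : 'I_N) : R := x ord0 l.

Definition evec (l : 'I_N) : 'rV[R]_N := \row_j (j == l)%:R.

Definition pder (l : 'I_N) (f : 'rV[R]_N -> R) : 'rV[R]_N -> R :=
  fun x => derive f x (evec l).

Definition vf_apply (z : 'rV[R]_N -> 'rV[R]_N) (f : 'rV[R]_N -> R)
  : 'rV[R]_N -> R :=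
  fun x => \sum_(k < N) xco (z x) k * pder k f x.

Definition ip (x y : 'rV[R]_N) : R := \sum_(l < N) xco x l * xco y l.
Definition sqn (x : 'rV[R]_N) : R := ip x x.
Definition ipm1 (lam : 'I_N -> R) (x y : 'rV[R]_N) : R :=
  \sum_(l < N) xco x l * xco y l / lam l.
Definition sqnm1 (lam : 'I_N -> R) (x : 'rV[R]_N) : R := ipm1 lam x x.

(* T_J for J = (k,l,m): sum over the cyclic permutations (a,b,c) of (k,l,m)
   of x_a x_b (1/lam_a - 1/lam_b) d_c *)
Definition Tfield (lam : 'I_N -> R) (k l m : 'I_N) (x : 'rV[R]_N) : 'rV[R]_N :=
  \row_c ( (c == m)%:R * (xco x k * xco x l * (lam k)^-1 - xco x k * xco x l * (lam l)^-1)
         + (c == k)%:R * (xco x l * xco x m * (lam l)^-1 - xco x l * xco x m * (lam m)^-1)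
         + (c == l)%:R * (xco x m * xco x k * (lam m)^-1 - xco x m * xco x k * (lam k)^-1)).

(* R_i = x_{2i} d_{2i-1} - x_{2i-1} d_{2i} (1-based); 0-based with j = 2i-2,
   j' = 2i-1 = j+1 this is x_{j'} d_j - x_j d_{j'} *)
Definition Rfield (j j' : 'I_N) (x : 'rV[R]_N) : 'rV[R]_N :=
  \row_c ((c == j)%:R * xco x j' - (c == j')%:R * xco x j).

Definition Dop (lam : 'I_N -> R) (f : 'rV[R]_N -> R) : 'rV[R]_N -> R :=
  fun x => 2^-1 *
   ( \sum_(k < N) \sum_(l < N) \sum_(m < N | (lam k < lam l) && (lam l < lam m))
        vf_apply (Tfield lam k l m) (vf_apply (Tfield lam k l m) f) x
   + \sum_(j < N | ~~ odd j) \sum_(j' < N | val j' == (val j).+1)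
        vf_apply (Rfield j j') (vf_apply (Rfield j j') f) x).

Definition gen (a kappa eps : R) (lam delta : 'I_N -> R)
  (b : 'rV[R]_N -> 'rV[R]_N) (f : 'rV[R]_N -> R) : 'rV[R]_N -> R :=
  fun x =>
    \sum_(l < N) lam l * (a / 2 * (1 + delta l) * pder l (pder l f) x
                          - xco x l * pder l f x)
    + eps^-1 * (vf_apply b f x + kappa * Dop lam f x).

Fixpoint iterD (s : seq 'I_N) (f : 'rV[R]_N -> R) : 'rV[R]_N -> R :=
  if s is l :: s' then pder l (iterD s' f) else f.
Definition smooth (f : 'rV[R]_N -> R) : Prop :=
  forall (s : seq 'I_N) (x : 'rV[R]_N), differentiable (iterD s f) x.
Definition test_fun (f : 'rV[R]_N -> R) : Prop :=
  smooth f /\ exists M : R, forall x, M < `|x| -> f x = 0.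

Section Process.
Context d (T : measurableType d).

(* natural filtration F_s = sigma(X_u, 0 <= u <= s) (X_u^-1 of Borel sets
   is generated by X_u^-1 of open sets) *)
Definition nat_filt (X : R -> T -> 'rV[R]_N) (s : R) : set (set T) :=
  <<s [set A | exists u (O : set 'rV[R]_N),
        [/\ 0 <= u, u <= s, open O & A = X u @^-1` O] ] >>.

Definition cont_process (X : R -> T -> 'rV[R]_N) : Prop :=
  (forall t (O : set 'rV[R]_N), open O -> measurable (X t @^-1` O)) /\
  (forall w, {within `[0, +oo[, continuous (fun t => X t w)}).

(* P solves the martingale problem for the operator L (on test functions
   C_c^oo): M^f_t = f(X_t) - f(X_0) - int_0^t Lf(X_u) du is a
   (P, F_t)-martingale, i.e. E[(M^f_t - M^f_s) 1_A] = 0 for A in F_s *)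
Definition solves_MP (L : ('rV[R]_N -> R) -> 'rV[R]_N -> R)
  (X : R -> T -> 'rV[R]_N) (P : probability T R) : Prop :=
  forall f, test_fun f ->
  forall s t (A : set T), 0 <= s -> s <= t -> nat_filt X s A ->
    (\int[P]_(w in A)
       (f (X t w) - f (X s w)
        - Rintegral (@lebesgue_measure R) `[s, t] (fun u => L f (X u w)))%:E
     = 0)%E.

Definition stationary (X : R -> T -> 'rV[R]_N) (P : probability T R) : Prop :=
  forall t (O : set 'rV[R]_N), 0 <= t -> open O ->
    P (X t @^-1` O) = P (X 0 @^-1` O).

Definition Wpath (lam : 'I_N -> R) (X : R -> T -> 'rV[R]_N) (w : T) : R -> R * R :=
  fun t => (sqn (X (Num.max t 0) w), sqnm1 lam (X (Num.max t 0) w)).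

End Process.

Definition lamN (lam : 'I_N -> R) : R := \big[Num.max/1]_(l < N) lam l.

Definition Cset (lam : 'I_N -> R) : set (R * R) :=
  [set p | 0 <= p.2 /\ p.2 <= p.1 /\ p.1 <= lamN lam * p.2].

(* C(R_+, C), embedded in C(R, R^2) by extending paths constantly to t < 0;
   this is a homeomorphism onto its image for the topologies of uniform
   convergence on compacts *)
Definition Cpaths (lam : 'I_N -> R) : set {family compact, R -> (R * R)%type} :=
  [set g | continuous (g : R -> R * R) /\ (forall t, t <= 0 -> g t = g 0) /\
           (forall t, Cset lam (g t))].

End Defs.

(* Main.v *)
(* Let [q] be [sqn] or [sqnm1]. The fields [b], [T_J] and [R_i] all annihilate
   [q], so the generator applied to a function of [q] does not involve [eps], and
   the drift and the bracket of [q] grow at most linearly in [q]. Hence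
   [V = ln (1 + q)] has bounded drift and bracket: for a smooth cutoff of [V - v]
   at scale [r], the martingale problem bounds the probability of moving by [r]
   within time [h] by a multiple of [h / r ^ 2] times the probability of having
   moved by [r / 2]. Two iterations give
   [P (|V_t - V_s| > 2 r) = O (h ^ 2 / r ^ 4)], uniformly in [eps] and without any
   moment bound, which is enough for Kolmogorov's chaining argument. The law of
   [q (X_0)] is tight by stationarity and a convex decreasing potential of [q], and
   compactness of the resulting sets of paths is Ascoli's theorem. *)

Require Import Defs.
From HB Require Import structures.
From mathcomp Require Import all_boot all_order all_algebra.
From mathcomp Require Import all_classical all_reals all_analysis.
From mathcomp Require Import measurable_realfun.
From mathcomp Require Import zify ring lra.
Set Implicit Arguments.
Unset Strict Implicit.
Unset Printing Implicit Defensive.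
Import Order.TTheory GRing.Theory Num.Theory.
Import numFieldNormedType.Exports.
Local Open Scope classical_set_scope.
Local Open Scope ring_scope.

(** * Flat functions *)

(** The martingale problem speaks only of fixed times, of events of the past and of compactly
    supported test functions; no stopping time is used. This shapes the increment bound. The centre
    [v] of a test function cannot follow the path, so the past is cut into events on which [V] at
    time [s] is nearly constant; the estimate on each of them carries the probability of that event,
    and the pieces add up to a bound without conditioning. A single use of the martingale problem
    gives a bound linear in [h], which the [1 / h] intervals of a mesh consume entirely; the second
    use gains the power of [h] that makes the chaining series converge. Test functions must have
    derivatives of all orders, hence the detour through [exp (- 1 / x)] extended by [0] and through
    a class of functions stable under partial derivatives, where smoothness costs one induction. *)

Section FlatExp.
Context {R : realType}.
Implicit Types (p : {poly R}) (x y : R).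

(** The polynomial parameter makes the family stable under differentiation: every derivative of
    [exp (- 1 / x)], extended by [0], is again a [flatexp]. *)
Definition flatexp p x : R := if 0 < x then p.[x^-1] * expR (- x^-1) else 0.

Lemma flatexp_le0 p x : x <= 0 -> flatexp p x = 0.
Proof. by rewrite /flatexp ltNge => ->. Qed.

Lemma flatexp_gt0 p x : 0 < x -> flatexp p x = p.[x^-1] * expR (- x^-1).
Proof. by rewrite /flatexp => ->. Qed.

Lemma pow_expRN_le k y : 0 <= y -> y ^+ k * expR (- y) <= k`!%:R.
Proof.
move=> y0; rewrite expRN ler_pdivrMr ?expR_gt0//.
case: k => [|k]; first by rewrite expr0 fact0 mul1r; apply: le_trans (expR_ge1Dx y); lra.
have := expR_ge1Dxn k y0.
rewrite -ler_pdivrMl ?ltr0n ?fact_gt0//.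
by apply: le_trans; rewrite mulrC lerDr.
Qed.

Lemma flatexp_bounded p : exists2 C, 0 <= C & forall x, `|flatexp p x| <= C.
Proof.
exists (\sum_(i < size p) `|p`_i| * (i`!)%:R).
  by apply: sumr_ge0 => i _; rewrite mulr_ge0.
move=> x; rewrite /flatexp; case: ifPn => [x0|_]; last first.
  by rewrite normr0; apply: sumr_ge0 => i _; rewrite mulr_ge0.
have y0 : 0 <= x^-1 by rewrite invr_ge0 ltW.
rewrite horner_coef mulr_suml; apply: (le_trans (ler_norm_sum _ _ _)).
apply: ler_sum => i _; rewrite -mulrA normrM ler_wpM2l//.
by rewrite ger0_norm ?pow_expRN_le// mulr_ge0 ?expR_ge0 ?exprn_ge0.
Qed.

(** Exhibits [flatexp p] as a bounded function times [x ^+ k], that is, as flat to every order at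
    the origin. *)
Lemma flatexpM p k x : flatexp ('X^k * p) x * x ^+ k = flatexp p x.
Proof.
rewrite /flatexp; case: ifPn => [x0|_]; last by rewrite mul0r.
rewrite hornerM hornerXn exprVn.
have : x ^+ k != 0 by rewrite expf_neq0 ?gt_eqF.
by move=> h; field.
Qed.

(** In the variable [y = 1 / x] one has [d/dx = - y ^ 2 d/dy], and applying this to [p(y) exp(- y)]
    gives [y ^ 2 (p - p') exp(- y)]. *)
Definition dflat p : {poly R} := 'X^2 * (p - p^`()).

Lemma is_derive_inv (y : R) : 0 < y -> is_derive y 1 (fun z : R => z^-1) (- (y ^-1) ^+ 2).
Proof.
move=> y0; have yn0 : y != 0 by rewrite gt_eqF.
apply: DeriveDef; first exact: derivableV.
by rewrite deriveV// derive_id /GRing.scale /= mulr1 exprVn.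
Qed.

Global Instance is_derive_flatexp p x :
  is_derive x 1 (flatexp p) (flatexp (dflat p) x).
Proof.
have [x0|x0|->] := ltgtP x 0.
- rewrite flatexp_le0 ?ltW//.
  apply: (@near_eq_is_derive _ _ _ (cst 0)) => //.
  near=> y; rewrite flatexp_le0//; apply/ltW; near: y; exact: lt_nbhsl.
- rewrite (flatexp_gt0 (dflat p))//.
  apply: (@near_eq_is_derive _ _ _ (fun y => p.[y^-1] * expR (- y^-1))).
    by near=> y; rewrite flatexp_gt0//; near: y; exact: lt_nbhsr.
  have -> : (fun y => p.[y^-1] * expR (- y^-1)) =
     ((horner p \o (fun y => y^-1)) * (expR \o (fun y => - y^-1)) : R -> R) by [].
  have dV := is_derive_inv x0.
  have dN := @is_deriveN _ _ _ _ _ _ _ dV.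
  apply: (@is_derive_eq _ _ _ _ _ _ _ _ (is_deriveM
     (@is_derive1_comp _ _ _ _ _ _ _ dV) (@is_derive1_comp _ _ _ _ _ _ _ dN))).
  rewrite /dflat /= !hornerE /GRing.scale /=; ring.
- rewrite flatexp_le0//.
  (* At the origin the quadratic bound [hp] makes the difference quotient of order [h], so the
     derivative is [0]. *)
  have [C C0 hC] := flatexp_bounded ('X^2 * p).
  have hp h : `|flatexp p h| <= C * h ^+ 2.
    by rewrite -(flatexpM p 2) normrM (ger0_norm (sqr_ge0 h)) ler_wpM2r ?sqr_ge0.
  have H : h^-1 *: (flatexp p (h *: 1 + 0) - flatexp p 0) @[h --> 0^'] --> (0:R).
    apply/cvgr0Pnorm_le => e e0.
    have e1 : 0 < e / (C + 1) by rewrite divr_gt0// ltr_wpDl.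
    near=> h.
    rewrite (flatexp_le0 p (lexx _)) subr0 addr0 /GRing.scale /= mulr1 normrM normfV.
    have h0 : h != 0 by near: h; exact: nbhs_dnbhs_neq.
    rewrite ler_pdivrMl ?normr_gt0//; apply: (le_trans (hp h)).
    rewrite -real_normK ?num_real// expr2 mulrA [leRHS]mulrC ler_wpM2r//.
    have : `|h| <= e / (C + 1).
      near: h; exact: dnbhs0_le.
    rewrite ler_pdivlMr ?ltr_wpDl// => hh.
    apply: le_trans hh; by rewrite mulrC ler_wpM2l// lerDl.
  by apply: DeriveDef; [apply/cvg_ex; exists 0 | exact: cvg_lim].
Unshelve. all: by end_near. Qed.

Lemma flatexp_ge0 x : 0 <= flatexp 1 x.
Proof. by rewrite /flatexp; case: ifP => // _; rewrite hornerE mul1r expR_ge0. Qed.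

Lemma flatexp_le x y : x <= y -> flatexp 1 x <= flatexp 1 y.
Proof.
have [x0|x0] := leP x 0; first by rewrite flatexp_le0 ?flatexp_ge0.
move=> xy; have y0 := lt_le_trans x0 xy.
by rewrite !flatexp_gt0// !hornerE ler_expR lerN2 lef_pV2.
Qed.

Lemma flatexp1 : flatexp 1 1 = expR (-1).
Proof. by rewrite flatexp_gt0// hornerE ?mul1r invr1. Qed.

End FlatExp.

(** * Smooth functions and radial derivatives *)

Section SmoothClass.
Context {R : realType} {N : nat}.
Implicit Types (f g : 'rV[R]_N -> R) (x : 'rV[R]_N) (l : 'I_N).

Lemma differentiable_comp1 (g : R -> R) f x (dg : R) :
  differentiable f x -> is_derive (f x) 1 g dg ->
  differentiable (fun y => g (f y)) x.
Proof.
move=> df [dg1 _]; apply: (differentiable_comp df).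
exact/derivable1_diffP.
Qed.

Lemma pder_comp l (g : R -> R) f x (dg : R) :
  differentiable f x -> is_derive (f x) 1 g dg ->
  pder l (fun y => g (f y)) x = dg * pder l f x.
Proof.
move=> df hg; have [dg1 <-] := hg.
rewrite /pder (deriveE _ (differentiable_comp1 df hg)) (deriveE _ df).
rewrite (diff_comp df) /=; last exact/derivable1_diffP.
by rewrite deriv1E// derive1E /GRing.scale /= mulrC.
Qed.

Lemma differentiable_xco x l : differentiable (fun y => xco y l) x.
Proof. exact: differentiable_coord. Qed.

Lemma pder_xco x k l : pder k (fun y => xco y l) x = (l == k)%:R.
Proof.
apply: cvg_lim => //; apply: cvg_near_cst; near=> h.
rewrite /= /xco /evec !mxE /GRing.scale /= addrK mulrA mulVf ?mul1r//.
by near: h; exact: nbhs_dnbhs_neq.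
Unshelve. all: by end_near. Qed.

Lemma pderD l f g x : differentiable f x -> differentiable g x ->
  pder l (fun y => f y + g y) x = pder l f x + pder l g x.
Proof.
by move=> df dg; rewrite /pder (@deriveD _ _ _ f g)//; exact: diff_derivable.
Qed.

Lemma pderM l f g x : differentiable f x -> differentiable g x ->
  pder l (fun y => f y * g y) x = f x * pder l g x + g x * pder l f x.
Proof.
by move=> df dg; rewrite /pder (@deriveM _ _ f g)//; exact: diff_derivable.
Qed.

(** [smooth] asks that all iterated partial derivatives be differentiable. A class of differentiable
    functions closed under [pder] has this property at once; the constructors are the operations
    needed for the test functions and their derivatives. *)
Inductive elementary : ('rV[R]_N -> R) -> Prop :=
| elem_cst (c : R) : elementary (fun=> c)
| elem_xco l : elementary (fun x => xco x l)
| elemD f g : elementary f -> elementary g -> elementary (fun x => f x + g x)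
| elemM f g : elementary f -> elementary g -> elementary (fun x => f x * g x)
| elem_flatexp p f : elementary f -> elementary (fun x => flatexp p (f x))
| elem_inv f : (forall x, 0 < f x) -> elementary f -> elementary (fun x => (f x)^-1)
| elem_ln f : (forall x, 0 < f x) -> elementary f -> elementary (fun x => ln (f x)).

Lemma elementary_differentiable f x : elementary f -> differentiable f x.
Proof.
move=> ef; elim: ef x => {f} [c|l|f g _ df _ dg|f g _ df _ dg|p f _ df|f f0 _ df|f f0 _ df] x.
- exact: differentiable_cst.
- exact: differentiable_xco.
- exact: differentiableD.
- exact: differentiableM.
- by apply: (@differentiable_comp1 (flatexp p) f); exact: df.
- by apply: differentiableV; rewrite ?gt_eqF.
- by apply: (@differentiable_comp1 (@ln R) f _ _ (df x)); exact: is_derive1_ln.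
Qed.

Lemma elementary_pder l f : elementary f -> elementary (pder l f).
Proof.
elim=> {f} [c|k|f g ef df eg dg|f g ef df eg dg|p f ef df|f f0 ef df|f f0 ef df].
- suff -> : pder l (fun=> c) = (fun=> 0) by exact: elem_cst.
  by apply/funext => x; rewrite /pder derive_cst.
- suff -> : pder l (fun x => xco x k) = (fun=> (k == l)%:R) by exact: elem_cst.
  by apply/funext => x; rewrite pder_xco.
- suff -> : pder l (fun x => f x + g x) = (fun x => pder l f x + pder l g x).
    exact: elemD.
  by apply/funext => x; rewrite pderD//; exact: elementary_differentiable.
- suff -> : pder l (fun x => f x * g x) = (fun x => f x * pder l g x + g x * pder l f x).
    by apply: elemD; exact: elemM.
  by apply/funext => x; rewrite pderM//; exact: elementary_differentiable.
- suff -> : pder l (fun x => flatexp p (f x)) = (fun x => flatexp (dflat p) (f x) * pder l f x).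
    by apply: elemM => //; exact: elem_flatexp.
  apply/funext => x; apply: (@pder_comp _ (flatexp p) f).
  exact: elementary_differentiable.
- suff -> : pder l (fun x => (f x)^-1) = (fun x => - 1 * ((f x)^-1 * (f x)^-1) * pder l f x).
    have ei := elem_inv f0 ef.
    by apply: elemM => //; apply: elemM; [exact: elem_cst|exact: elemM].
  apply/funext => x.
  rewrite (@pder_comp l (fun z => z^-1) f x _ (elementary_differentiable x ef)
    (is_derive_inv (f0 x))).
  by rewrite mulN1r expr2.
- suff -> : pder l (fun x => ln (f x)) = (fun x => (f x)^-1 * pder l f x).
    by apply: elemM => //; exact: elem_inv.
  apply/funext => x; apply: (@pder_comp _ (@ln R) f).
    exact: elementary_differentiable.
  exact: is_derive1_ln.
Qed.

Lemma elementary_smooth f : elementary f -> smooth f.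
Proof.
move=> ef s x; apply: elementary_differentiable.
by elim: s => //= l s; exact: elementary_pder.
Qed.

Lemma elementary_continuous f : elementary f -> continuous f.
Proof.
by move=> ef x; exact/differentiable_continuous/elementary_differentiable.
Qed.

Lemma elementary_sum (I : Type) (r : seq I) (P : pred I) (F : I -> 'rV[R]_N -> R) :
  (forall i, elementary (F i)) -> elementary (fun x => \sum_(i <- r | P i) F i x).
Proof.
move=> eF; elim: r => [|i r IH].
  by under [fun _ => _]funext do rewrite big_nil; exact: elem_cst.
under [fun _ => _]funext do rewrite big_cons.
by case: (P i) => //; exact: elemD.
Qed.

End SmoothClass.

Section Radial.
Context {R : realType} {N : nat} (c : 'I_N -> R).
Implicit Types (x : 'rV[R]_N) (l : 'I_N).

Definition wsq x : R := \sum_(l < N) c l * xco x l ^+ 2.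

Let elementary_term l : elementary (fun x => c l * xco x l ^+ 2).
Proof.
apply: elemM; first exact: elem_cst.
by under [fun _ => _]funext do rewrite expr2; apply: elemM; exact: elem_xco.
Qed.

Lemma elementary_wsq : elementary wsq.
Proof. exact: elementary_sum. Qed.

Lemma differentiable_wsq x : differentiable wsq x.
Proof. exact/elementary_differentiable/elementary_wsq. Qed.

Lemma pder_wsq l x : pder l wsq x = 2 * c l * xco x l.
Proof.
have dd k y : differentiable (fun x => c k * xco x k ^+ 2) y.
  exact: elementary_differentiable.
have -> : wsq = \sum_(k < N) (fun x => c k * xco x k ^+ 2).
  by apply/funext => y; rewrite fct_sumE.
rewrite /pder derive_sum; last by move=> k; exact: diff_derivable.
have dsq k : pder l (fun x => c k * xco x k ^+ 2) x = c k * (2 * xco x k) * (k == l)%:R.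
  have dk : is_derive (xco x k) 1 (fun z => c k * z ^+ 2) (c k * (2 * xco x k)).
    by apply: is_derive_eq; rewrite /GRing.scale /=; ring.
  rewrite (@pder_comp _ _ l (fun z => c k * z ^+ 2) _ x _ (differentiable_xco x k) dk).
  by rewrite pder_xco.
rewrite (bigD1 l)//= big1 ?addr0 => [|k kl].
  rewrite -[LHS]/(pder l (fun x => c l * xco x l ^+ 2) x) dsq eqxx mulr1; ring.
by rewrite -[LHS]/(pder l (fun x => c k * xco x k ^+ 2) x) dsq (negbTE kl) mulr0.
Qed.

Hypothesis c_ge0 : forall l, 0 <= c l.

Lemma wsq_ge0 x : 0 <= wsq x.
Proof. by apply: sumr_ge0 => l _; rewrite mulr_ge0 ?sqr_ge0. Qed.

Section Chain.
Variables psi psi1 psi2 : R -> R.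
(** Nonnegative arguments suffice because [wsq] takes no others; [ln (1 + y)] is differentiable
    there but not on the whole line. *)
Hypothesis dpsi : forall y : R, 0 <= y -> is_derive y 1 psi (psi1 y).
Hypothesis dpsi1 : forall y : R, 0 <= y -> is_derive y 1 psi1 (psi2 y).

Let f x := psi (wsq x).

Lemma pder_radial l x : pder l f x = psi1 (wsq x) * (2 * c l * xco x l).
Proof.
rewrite (@pder_comp _ _ l psi wsq x _ (differentiable_wsq x) (dpsi (wsq_ge0 x))).
by rewrite pder_wsq.
Qed.

Lemma pder2_radial l x : pder l (pder l f) x =
  psi2 (wsq x) * (2 * c l * xco x l) ^+ 2 + psi1 (wsq x) * (2 * c l).
Proof.
have -> : pder l f = (fun y => psi1 (wsq y) * (2 * c l * xco y l)).
  by apply/funext => y; exact: pder_radial.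
have dp1 := dpsi1 (wsq_ge0 x).
have d1 : differentiable (fun y => psi1 (wsq y)) x.
  exact: (@differentiable_comp1 _ _ psi1 wsq x _ (differentiable_wsq x) dp1).
have dl : is_derive (xco x l) 1 (fun z => 2 * c l * z) (2 * c l).
  by apply: is_derive_eq; rewrite /GRing.scale /=; ring.
have d2 : differentiable (fun y => 2 * c l * xco y l) x.
  exact: (@differentiable_comp1 _ _ (fun z => 2 * c l * z) _ _ _ (differentiable_xco x l) dl).
rewrite pderM//.
rewrite (@pder_comp _ _ l psi1 wsq x _ (differentiable_wsq x) dp1) pder_wsq.
rewrite (@pder_comp _ _ l (fun z => 2 * c l * z) _ _ _ (differentiable_xco x l) dl).
rewrite pder_xco eqxx mulr1; ring.
Qed.

(** The hypothesis says that [z] is tangent to the level sets of [wsq]. The conclusion is an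
    equality of functions so that it can be rewritten under the outer field in the squares of
    [Dop]. *)
Lemma vf_radial (z : 'rV[R]_N -> 'rV[R]_N) :
  (forall x, \sum_(l < N) c l * xco x l * xco (z x) l = 0) ->
  vf_apply z f = (fun=> 0).
Proof.
move=> hz; apply/funext => x; rewrite /vf_apply.
under eq_bigr do rewrite pder_radial.
transitivity (2 * psi1 (wsq x) * \sum_(l < N) c l * xco x l * xco (z x) l).
  by rewrite mulr_sumr; apply: eq_bigr => l _; ring.
by rewrite hz mulr0.
Qed.

Lemma vf_apply0 (z : 'rV[R]_N -> 'rV[R]_N) : vf_apply z (fun=> 0) = (fun=> 0).
Proof.
apply/funext => x; rewrite /vf_apply big1// => k _.
by rewrite /pder derive_cst mulr0.
Qed.

End Chain.
End Radial.

(** * Radial test functions and the generator *)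

Section Cutoff.
Context {R : realType}.
Implicit Types y : R.

Let E0 := @flatexp R 1.
Let E1 := @flatexp R (dflat 1).
Let E2 := @flatexp R (dflat (dflat 1)).

(** A smooth step from [expR (-1)] down to [0]: since [E0 1 = expR (-1)], the inner argument is [1]
    for [y <= 0] and nonpositive for [1 <= y]. The plateau is left at [expR (-1)]; the factor is
    undone in [away_step]. *)
Definition cutoff y : R := E0 (1 - expR 1 * E0 y).
Definition cutoff1 y : R := E1 (1 - expR 1 * E0 y) * (- (expR 1 * E1 y)).
Definition cutoff2 y : R :=
  E2 (1 - expR 1 * E0 y) * (expR 1 * E1 y) ^+ 2
  + E1 (1 - expR 1 * E0 y) * (- (expR 1 * E2 y)).

Lemma is_derive_cutoff y : is_derive y 1 cutoff (cutoff1 y).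
Proof.
have d1 : is_derive y 1 (fun z => 1 - expR 1 * E0 z) (- (expR 1 * E1 y)).
  by apply: is_derive_eq; rewrite /GRing.scale /= /E1; ring.
exact: (@is_derive1_comp _ E0 _ _ _ _ (is_derive_flatexp 1 _) d1).
Qed.

Lemma is_derive_cutoff1 y : is_derive y 1 cutoff1 (cutoff2 y).
Proof.
have d1 : is_derive y 1 (fun z => 1 - expR 1 * E0 z) (- (expR 1 * E1 y)).
  by apply: is_derive_eq; rewrite /GRing.scale /= /E1; ring.
have d2 : is_derive y 1 (fun z => - (expR 1 * E1 z)) (- (expR 1 * E2 y)).
  by apply: is_derive_eq; rewrite /GRing.scale /= /E2; ring.
have d3 := @is_derive1_comp _ E1 _ _ _ _ (is_derive_flatexp (dflat 1) _) d1.
apply: (@is_derive_eq _ _ _ _ _ _ _ _ (is_deriveM d3 d2)).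
rewrite /cutoff2 /GRing.scale /= -/E2; ring.
Qed.

Lemma cutoff_arg_le0 y : 1 <= y -> 1 - expR 1 * E0 y <= 0.
Proof.
move=> y1; rewrite subr_le0.
have e1 : 1 = expR 1 * E0 1 :> R by rewrite /E0 flatexp1 -expRD subrr expR0.
by rewrite [leLHS]e1 ler_wpM2l ?expR_ge0//; exact: flatexp_le.
Qed.

Lemma cutoff_le0 y : y <= 0 -> cutoff y = expR (-1).
Proof. by move=> y0; rewrite /cutoff {2}/E0 flatexp_le0// mulr0 subr0 /E0 flatexp1. Qed.

Lemma cutoff_ge1 y : 1 <= y -> cutoff y = 0.
Proof. by move=> /cutoff_arg_le0 h; rewrite /cutoff /E0 flatexp_le0. Qed.

Lemma cutoff_ge0 y : 0 <= cutoff y.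
Proof. exact: flatexp_ge0. Qed.

Lemma cutoff_le y : cutoff y <= expR (-1).
Proof.
rewrite -flatexp1; apply: flatexp_le.
by rewrite gerBl mulr_ge0 ?expR_ge0 ?flatexp_ge0.
Qed.

Lemma cutoff12_out y : (y <= 0) || (1 <= y) -> cutoff1 y = 0 /\ cutoff2 y = 0.
Proof.
move=> /orP[y0|y1]; rewrite /cutoff1 /cutoff2.
  have e1 : E1 y = 0 by exact: flatexp_le0.
  have e2 : E2 y = 0 by exact: flatexp_le0.
  by rewrite e1 e2 !mulr0 oppr0 expr0n /= !mulr0 addr0.
have h := cutoff_arg_le0 y1.
have e1 : E1 (1 - expR 1 * E0 y) = 0 by exact: flatexp_le0.
have e2 : E2 (1 - expR 1 * E0 y) = 0 by exact: flatexp_le0.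
by rewrite e1 e2 !mul0r addr0.
Qed.

Lemma cutoff12_bounded :
  exists2 B, 0 <= B & forall y, `|cutoff1 y| <= B /\ `|cutoff2 y| <= B.
Proof.
have [B1 B10 h1] := @flatexp_bounded R (dflat 1).
have [B2 B20 h2] := @flatexp_bounded R (dflat (dflat 1)).
have e0 : 0 <= expR 1 :> R by exact: expR_ge0.
have n1 y : `|cutoff1 y| <= B1 * (expR 1 * B1).
  by rewrite normrM normrN normrM (ger0_norm e0) !ler_pM ?mulr_ge0.
have n2 y : `|cutoff2 y| <= B2 * (expR 1 * B1) ^+ 2 + B1 * (expR 1 * B2).
  apply: (le_trans (ler_normD _ _)); apply: lerD.
    rewrite normrM normrX ler_pM// ler_pXn2r ?nnegrE ?mulr_ge0//.
    by rewrite normrM (ger0_norm e0) ler_wpM2l.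
  by rewrite normrM normrN normrM (ger0_norm e0) !ler_pM ?mulr_ge0.
have b1 : 0 <= B1 * (expR 1 * B1) by rewrite !mulr_ge0.
have b2 : 0 <= B2 * (expR 1 * B1) ^+ 2 + B1 * (expR 1 * B2).
  by rewrite addr_ge0 ?mulr_ge0 ?sqr_ge0 ?mulr_ge0.
exists (B1 * (expR 1 * B1) + (B2 * (expR 1 * B1) ^+ 2 + B1 * (expR 1 * B2))).
  exact: addr_ge0.
by move=> y; split; [apply: (le_trans (n1 y)); rewrite lerDl|
                     apply: (le_trans (n2 y)); rewrite lerDr].
Qed.

End Cutoff.

Section GenRadial.
Context {R : realType} {N : nat} (a kappa al be : R) (lam delta : 'I_N -> R)
  (b : 'rV[R]_N -> 'rV[R]_N).
Implicit Types (x : 'rV[R]_N) (l : 'I_N).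
Hypothesis a_gt0 : 0 < a.
Hypothesis lam_ge1 : forall l, 1 <= lam l.
Hypothesis lam_pair : forall k l : 'I_N, k./2 = l./2 -> lam k = lam l.
Hypothesis deltaP : forall l, -1 < delta l <= 0.
Hypothesis b_ip : forall x, ip x (b x) = 0.
Hypothesis b_ipm1 : forall x, ipm1 lam x (b x) = 0.
Hypotheses (al_ge0 : 0 <= al) (be_ge0 : 0 <= be).
Hypothesis albe_gt0 : 0 < al + be.

(* The squared norms whose weights are affine in [1 / lam] are annihilated by every
   [Tfield]; [(al, be) = (1, 0)] gives [sqn] and [(0, 1)] gives [sqnm1]. *)
Definition wt l : R := al + be / lam l.

Local Notation q := (wsq wt).

Let lam_gt0 l : 0 < lam l.
Proof. exact: lt_le_trans (lam_ge1 l). Qed.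

Lemma wt_gt0 l : 0 < wt l.
Proof.
have := lam_gt0 l; rewrite -invr_gt0 /wt => i0.
have [al0|al0] := ltP 0 al; first by rewrite ltr_wpDr// mulr_ge0// ltW.
have be0 : 0 < be by apply: lt_le_trans albe_gt0 _; rewrite gerDr.
by rewrite ltr_wpDl// mulr_gt0.
Qed.

Let wt_ge0 l : 0 <= wt l. Proof. exact/ltW/wt_gt0. Qed.

Let sum_delta (F : 'I_N -> R) m : \sum_(i < N) (i == m)%:R * F i = F m.
Proof.
rewrite (bigD1 m)//= eqxx mul1r big1 ?addr0// => i im.
by rewrite (negbTE im) mul0r.
Qed.

Lemma wt_b x : \sum_(l < N) wt l * xco x l * xco (b x) l = 0.
Proof.
transitivity (al * ip x (b x) + be * ipm1 lam x (b x)); last first.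
  by rewrite b_ip b_ipm1 !mulr0 addr0.
rewrite /ip /ipm1 !mulr_sumr -big_split /=; apply: eq_bigr => l _.
by rewrite /wt; ring.
Qed.

(** With [u = 1 / lam], the sum is [x_k x_l x_m] times the cyclic sum of [wt_c (u_a - u_b)], which
    vanishes for constant weights and for the weight [u]. *)
Lemma wt_Tfield k l m x :
  \sum_(i < N) wt i * xco x i * xco (Tfield lam k l m x) i = 0.
Proof.
under eq_bigr => i _.
  rewrite {2}/xco mxE.
  rewrite (_ : _ * _ =
    (i == m)%:R * (wt i * xco x i * (xco x k * xco x l * (lam k)^-1 - xco x k * xco x l * (lam l)^-1))
  + (i == k)%:R * (wt i * xco x i * (xco x l * xco x m * (lam l)^-1 - xco x l * xco x m * (lam m)^-1))
  + (i == l)%:R * (wt i * xco x i * (xco x m * xco x k * (lam m)^-1 - xco x m * xco x k * (lam k)^-1)));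
    last by ring.
  over.
by rewrite !big_split /= !sum_delta /wt; ring.
Qed.

(** The field rotates a coordinate plane on which the weight is constant: for even [j], the indices
    [j] and [j + 1] form one pair of equal [lam]. *)
Lemma wt_Rfield (j j' : 'I_N) x : ~~ odd j -> val j' == (val j).+1 ->
  \sum_(i < N) wt i * xco x i * xco (Rfield j j' x) i = 0.
Proof.
move=> oj /eqP jj'.
have ljj' : lam j' = lam j.
  by apply: lam_pair; rewrite -[nat_of_ord j']/(val j') jj' /= uphalf_half (negbTE oj).
under eq_bigr => i _.
  rewrite {2}/xco mxE.
  rewrite (_ : _ * _ = (i == j)%:R * (wt i * xco x i * xco x j')
    + (i == j')%:R * (- (wt i * xco x i * xco x j))); last by ring.
  over.
by rewrite big_split /= !sum_delta /wt ljj'; ring.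
Qed.

(** [drift] is the second-order operator applied to [q]; [carre] is the coefficient of the second
    derivative of [psi] in the generator of [psi (q)], half the density of the bracket of [q]. *)
Definition drift x : R :=
  \sum_(l < N) lam l * (a / 2 * (1 + delta l) * (2 * wt l) - xco x l * (2 * wt l * xco x l)).
Definition carre x : R :=
  \sum_(l < N) lam l * (a / 2 * (1 + delta l) * (2 * wt l * xco x l) ^+ 2).

Definition wtmass : R := \sum_(l < N) lam l * a * wt l.
Definition lamsum : R := \sum_(l < N) lam l.

Lemma wtmass_ge0 : 0 <= wtmass.
Proof. by apply: sumr_ge0 => l _; rewrite !mulr_ge0// ltW. Qed.

Lemma lamsum_ge0 : 0 <= lamsum.
Proof. by apply: sumr_ge0 => l _; rewrite ltW. Qed.

(** The restoring term [- 2 * q] comes from [1 <= lam l]; it is the source of the confinement behind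
    [confining_gen]. *)
Lemma drift_le x : drift x <= wtmass - 2 * q x.
Proof.
rewrite /drift /wtmass /wsq mulr_sumr -sumrB; apply: ler_sum => l _.
have /andP[d1 d0] := deltaP l.
have h1 : 0 <= lam l * a * wt l by rewrite !mulr_ge0// ltW.
have h2 : 0 <= wt l * xco x l ^+ 2 by rewrite mulr_ge0 ?sqr_ge0.
have h3 := lam_ge1 l.
have -> : lam l * (a / 2 * (1 + delta l) * (2 * wt l) - xco x l * (2 * wt l * xco x l))
  = lam l * a * wt l * (1 + delta l) - 2 * (lam l * (wt l * xco x l ^+ 2)) by field.
apply: lerB; first by rewrite ler_piMr//; lra.
by rewrite ler_wpM2l// ler_peMl.
Qed.

Lemma drift_ge x : - (2 * lamsum * q x) <= drift x.
Proof.
rewrite /drift /wsq mulr_sumr -sumrN; apply: ler_sum => l _.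
have /andP[d1 d0] := deltaP l.
have h1 : 0 <= lam l * a * wt l * (1 + delta l).
  rewrite mulr_ge0//; last lra.
  by rewrite !mulr_ge0// ltW.
have h2 : 0 <= wt l * xco x l ^+ 2 by rewrite mulr_ge0 ?sqr_ge0.
have h3 : lam l <= lamsum.
  by rewrite /lamsum (bigD1 l)//= lerDl sumr_ge0// => i _; rewrite ltW.
have -> : lam l * (a / 2 * (1 + delta l) * (2 * wt l) - xco x l * (2 * wt l * xco x l))
  = lam l * a * wt l * (1 + delta l) - 2 * (lam l * (wt l * xco x l ^+ 2)) by field.
have : lam l * (wt l * xco x l ^+ 2) <= lamsum * (wt l * xco x l ^+ 2) by rewrite ler_wpM2r.
move: h1; lra.
Qed.

Lemma carre_ge0 x : 0 <= carre x.
Proof.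
apply: sumr_ge0 => l _; have /andP[d1 d0] := deltaP l.
have d2 : 0 <= 1 + delta l by lra.
have a2 : 0 <= a / 2 by rewrite divr_ge0// ltW.
apply: mulr_ge0; first exact: ltW.
by apply: mulr_ge0; [exact: mulr_ge0 | exact: sqr_ge0].
Qed.

Lemma carre_le x : carre x <= 2 * wtmass * q x.
Proof.
rewrite /carre /wsq mulr_sumr; apply: ler_sum => l _.
have /andP[d1 d0] := deltaP l.
have h1 : 0 <= lam l * a * wt l by rewrite !mulr_ge0// ltW.
have h2 : 0 <= wt l * xco x l ^+ 2 by rewrite mulr_ge0 ?sqr_ge0.
have h3 : lam l * a * wt l <= wtmass.
  rewrite /wtmass (bigD1 l)//= lerDl sumr_ge0// => i _.
  by rewrite !mulr_ge0// ltW.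
have -> : lam l * (a / 2 * (1 + delta l) * (2 * wt l * xco x l) ^+ 2)
  = 2 * (lam l * a * wt l * (1 + delta l)) * (wt l * xco x l ^+ 2) by field.
rewrite ler_wpM2r// ler_wpM2l//; apply: le_trans h3.
by rewrite ler_piMr//; lra.
Qed.

Definition growth : R := 2 * wtmass + 2 * lamsum.

Lemma growth_ge0 : 0 <= growth.
Proof. by have := wtmass_ge0; have := lamsum_ge0; rewrite /growth; lra. Qed.

Lemma drift_growth x : `|drift x| <= growth * (1 + q x).
Proof.
have q0 := wsq_ge0 wt_ge0 x; have A0 := wtmass_ge0; have L0 := lamsum_ge0.
have h1 := drift_le x; have h2 := drift_ge x.
rewrite ler_norml /growth; apply/andP; split.
  by apply: le_trans h2; have := mulr_ge0 A0 q0; have := mulr_ge0 L0 q0; lra.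
by apply: (le_trans h1); have := mulr_ge0 A0 q0; have := mulr_ge0 L0 q0; lra.
Qed.

Lemma carre_growth x : `|carre x| <= growth * (1 + q x) ^+ 2.
Proof.
have q0 := wsq_ge0 wt_ge0 x; have A0 := wtmass_ge0; have L0 := lamsum_ge0.
rewrite ger0_norm ?carre_ge0//; apply: (le_trans (carre_le x)).
apply: (@le_trans _ _ (growth * q x)).
  by rewrite ler_wpM2r// /growth; lra.
by rewrite ler_wpM2l ?growth_ge0//; nra.
Qed.

Lemma wsq_coercive Q : exists M : R, forall x, M < `|x| -> Q <= q x.
Proof.
have i0 l : 0 < (wt l)^-1 by rewrite invr_gt0 wt_gt0.
pose W := \sum_(l < N) (wt l)^-1.
have W0 : 0 <= W by apply: sumr_ge0 => l _; exact: ltW.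
(* The norm is the largest absolute value of a coordinate. The summand [1] keeps it above [1], so
   that squaring this coordinate does not decrease it. *)
exists (1 + `|Q| * W) => x hx.
have M1 : 1 <= 1 + `|Q| * W by rewrite lerDl mulr_ge0.
have xn0 : mx_norm x != 0 by rewrite gt_eqF// (lt_trans _ hx)// (lt_le_trans _ M1).
have [[i l] /= xl] := mx_norm_neq0 xn0.
have {xl} xl : `|x| = `|xco x l| by rewrite -[LHS]/(mx_norm x) xl (ord1 i).
have iW : (wt l)^-1 <= W.
  by rewrite /W (bigD1 l)//= lerDl sumr_ge0// => j _; exact: ltW.
have xq : wt l * xco x l ^+ 2 <= q x.
  by rewrite /wsq (bigD1 l)//= lerDl sumr_ge0// => j _; rewrite mulr_ge0 ?sqr_ge0.
have q0 := wsq_ge0 wt_ge0 x.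
have h1 : xco x l ^+ 2 <= q x * W.
  rewrite -[leLHS](mulKf (lt0r_neq0 (wt_gt0 l))) mulrC.
  by apply: ler_pM => //; [rewrite mulr_ge0 ?sqr_ge0 | exact: ltW].
have h2 : 1 + `|Q| * W <= xco x l ^+ 2.
  by rewrite -real_normK ?num_real// -xl; nra.
have : `|Q| * W < q x * W by lra.
rewrite ltr_pM2r; last exact: lt_le_trans iW.
by move/ltW; apply: le_trans; exact: ler_norm.
Qed.

Section Psi.
Variables psi psi1 psi2 : R -> R.
Hypothesis dpsi : forall y : R, 0 <= y -> is_derive y 1 psi (psi1 y).
Hypothesis dpsi1 : forall y : R, 0 <= y -> is_derive y 1 psi1 (psi2 y).
Hypothesis epsi : elementary (fun x => psi (q x)).

Local Notation f := (fun x => psi (q x)).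

Lemma gen_radial_aux eps x : gen a kappa eps lam delta b f x =
  \sum_(l < N) lam l * (a / 2 * (1 + delta l) * pder l (pder l f) x
                        - xco x l * pder l f x).
Proof.
suff -> : gen a kappa eps lam delta b f x =
  \sum_(l < N) lam l * (a / 2 * (1 + delta l) * pder l (pder l f) x
                        - xco x l * pder l f x) + eps^-1 * (0 + kappa * 0).
  by rewrite !mulr0 addr0 mulr0 addr0.
rewrite /gen (vf_radial wt_ge0 dpsi wt_b); congr (_ + _ * (_ + _ * _)).
rewrite /Dop big1 ?add0r => [|k _]; last first.
  rewrite big1// => l _; rewrite big1// => m _.
  by rewrite (vf_radial wt_ge0 dpsi (wt_Tfield k l m)) vf_apply0.
rewrite big1 ?mulr0// => j oj; rewrite big1// => j' jj'.
by rewrite (vf_radial wt_ge0 dpsi (fun x => wt_Rfield x oj jj')) vf_apply0.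
Qed.

Lemma gen_radial eps x : gen a kappa eps lam delta b f x =
  psi1 (q x) * drift x + psi2 (q x) * carre x.
Proof.
rewrite gen_radial_aux /drift /carre !mulr_sumr -big_split /=.
apply: eq_bigr => l _.
by rewrite (pder2_radial wt_ge0 dpsi dpsi1) (pder_radial wt_ge0 dpsi); ring.
Qed.

(** Continuity is read off the partial derivatives, which are elementary, rather than off
    [gen_radial], which would require continuity of [psi1] and [psi2]. *)
Lemma gen_radial_continuous eps : continuous (gen a kappa eps lam delta b f).
Proof.
have -> : gen a kappa eps lam delta b f = (fun x =>
  \sum_(l < N) (lam l * (a / 2 * (1 + delta l))) * pder l (pder l f) x
  + \sum_(l < N) (- lam l) * (xco x l * pder l f x)).
  apply/funext => x; rewrite gen_radial_aux -big_split /=.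
  by apply: eq_bigr => l _; ring.
apply: elementary_continuous; apply: elemD; apply: elementary_sum => l;
  (apply: elemM; first exact: elem_cst).
  by do 2 apply: elementary_pder.
by apply: elemM; [exact: elem_xco|exact: elementary_pder].
Qed.

(** The weights [1 + q] and [(1 + q) ^+ 2] are the growth rates of [drift] and [carre]; a function
    of [ln (1 + q)] has derivatives that compensate them exactly. *)
Lemma gen_radial_norm_le eps D1 D2 x :
  `|psi1 (q x)| * (1 + q x) <= D1 -> `|psi2 (q x)| * (1 + q x) ^+ 2 <= D2 ->
  `|gen a kappa eps lam delta b f x| <= growth * (D1 + D2).
Proof.
move=> h1 h2; rewrite gen_radial; apply: (le_trans (ler_normD _ _)).
rewrite !normrM mulrDr; apply: lerD.
  apply: (le_trans (ler_wpM2l (normr_ge0 _) (drift_growth x))).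
  by rewrite mulrCA ler_wpM2l ?growth_ge0.
apply: (le_trans (ler_wpM2l (normr_ge0 _) (carre_growth x))).
by rewrite mulrCA ler_wpM2l ?growth_ge0.
Qed.

Lemma test_fun_radial Q : (forall y, Q <= y -> psi y = 0) -> test_fun f.
Proof.
move=> hQ; split; first exact: elementary_smooth.
by have [M hM] := wsq_coercive Q; exists M => x /hM /hQ.
Qed.

End Psi.

Definition logw x : R := ln (1 + q x).

Let q1_gt0 x : 0 < 1 + q x.
Proof. by rewrite ltr_pwDl// wsq_ge0. Qed.

Lemma elementary_logw : elementary logw.
Proof.
by apply: elem_ln => //; apply: elemD; [exact: elem_cst|exact: elementary_wsq].
Qed.

Lemma logw_continuous : continuous logw.
Proof. exact/elementary_continuous/elementary_logw. Qed.

Lemma logw_ge0 x : 0 <= logw x.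
Proof. by rewrite ln_ge0// lerDl wsq_ge0. Qed.

(** Nonpositive exactly when the distance of [ln (1 + y)] to [v] is at most [r / 2], and at least
    [1] once that distance reaches [r]. The square avoids the corner of the absolute value. *)
Definition bump_arg (r v y : R) : R := 4 / r ^+ 2 * (ln (1 + y) - v) ^+ 2 - 1.
Definition bump_arg1 (r v y : R) : R := 8 / r ^+ 2 * (ln (1 + y) - v) * (1 + y)^-1.
Definition bump_arg2 (r v y : R) : R :=
  8 / r ^+ 2 * (1 - (ln (1 + y) - v)) * (1 + y)^-1 ^+ 2.

Let is_derive_ln1 (y : R) : 0 <= y -> is_derive y 1 (fun y : R => ln (1 + y)) (1 + y)^-1.
Proof.
move=> y0; have y1 : 0 < 1 + y by lra.
have d1 : is_derive y 1 (fun z : R => 1 + z) 1.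
  by apply: is_derive_eq; rewrite add0r ?mulr1.
have := @is_derive1_comp _ (@ln R) _ _ _ _ (is_derive1_ln y1) d1.
by rewrite mulr1.
Qed.

Lemma is_derive_bump_arg (r v y : R) : 0 <= y ->
  is_derive y 1 (bump_arg r v) (bump_arg1 r v y).
Proof.
move=> y0; have d1 := is_derive_ln1 y0.
have d2 : is_derive (ln (1 + y)) 1 (fun z => 4 / r ^+ 2 * (z - v) ^+ 2 - 1)
    (8 / r ^+ 2 * (ln (1 + y) - v)).
  by apply: is_derive_eq; rewrite /GRing.scale /=; ring.
exact: (@is_derive1_comp _ _ (fun y : R => ln (1 + y)) _ _ _ d2 d1).
Qed.

Lemma is_derive_bump_arg1 (r v y : R) : 0 <= y ->
  is_derive y 1 (bump_arg1 r v) (bump_arg2 r v y).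
Proof.
move=> y0; have d1 := is_derive_ln1 y0.
have y1 : 0 < 1 + y by lra.
have d2 : is_derive (ln (1 + y)) 1 (fun z => 8 / r ^+ 2 * (z - v)) (8 / r ^+ 2).
  by apply: is_derive_eq; rewrite /GRing.scale /=; ring.
have d3 := @is_derive1_comp _ _ (fun y : R => ln (1 + y)) _ _ _ d2 d1.
have d4 : is_derive y 1 (fun z : R => 1 + z) 1.
  by apply: is_derive_eq; rewrite add0r ?mulr1.
have d5 := @is_derive1_comp _ _ (fun z : R => 1 + z) _ _ _ (is_derive_inv y1) d4.
apply: (@is_derive_eq _ _ _ _ _ _ _ _ (is_deriveM d3 d5)).
by rewrite /bump_arg2 /GRing.scale /=; ring.
Qed.

Lemma bump_gen : exists2 D, 0 <= D & forall eps r v : R, 0 < r ->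
  exists f : 'rV[R]_N -> R, [/\ test_fun f,
    continuous (gen a kappa eps lam delta b f),
    forall x, 0 <= f x <= expR (-1) /\
      `|gen a kappa eps lam delta b f x| <= D * (r^-1 + r^-1 ^+ 2),
    forall x, `|logw x - v| <= r / 2 ->
      f x = expR (-1) /\ gen a kappa eps lam delta b f x = 0 &
    forall x, r <= `|logw x - v| -> f x = 0].
Proof.
have [B B0 hB] := @cutoff12_bounded R.
(* The estimates below add up to [B] times [16 / r + 72 / r ^ 2]; [80] dominates both
   coefficients. *)
exists (growth * (80 * B)); first by rewrite mulr_ge0 ?growth_ge0// mulr_ge0.
move=> eps r v r0.
pose psi y := cutoff (bump_arg r v y).
pose psi1 y := cutoff1 (bump_arg r v y) * bump_arg1 r v y.
pose psi2 y := cutoff2 (bump_arg r v y) * bump_arg1 r v y ^+ 2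
   + cutoff1 (bump_arg r v y) * bump_arg2 r v y.
have dpsi (y : R) : 0 <= y -> is_derive y 1 psi (psi1 y).
  move=> y0; exact: (@is_derive1_comp _ _ (bump_arg r v) _ _ _ (is_derive_cutoff _)
    (is_derive_bump_arg r v y0)).
have dpsi1 (y : R) : 0 <= y -> is_derive y 1 psi1 (psi2 y).
  move=> y0.
  have d1 := @is_derive1_comp _ _ (bump_arg r v) _ _ _ (is_derive_cutoff1 _)
    (is_derive_bump_arg r v y0).
  apply: (@is_derive_eq _ _ _ _ _ _ _ _ (is_deriveM d1 (is_derive_bump_arg1 r v y0))).
  by rewrite /psi2 /GRing.scale /=; ring.
have ea : elementary (fun x => bump_arg r v (q x)).
  apply: elemD; last exact: elem_cst.
  apply: elemM; first exact: elem_cst.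
  under [fun _ => _]funext do rewrite expr2.
  by apply: elemM; (apply: elemD; [exact: elementary_logw|exact: elem_cst]).
have epsi : elementary (fun x => psi (q x)).
  apply: elem_flatexp; apply: elemD; first exact: elem_cst.
  under [fun _ => _]funext do rewrite -mulNr.
  by apply: elemM; [exact: elem_cst|exact: elem_flatexp].
have r2 : 0 < r ^+ 2 by rewrite exprn_gt0.
have argE (z : R) : 4 / r ^+ 2 * z ^+ 2 - 1 = (4 * `|z| ^+ 2 - r ^+ 2) / r ^+ 2.
  by rewrite real_normK ?num_real//; field; rewrite gt_eqF.
have arg_le0 y : `|ln (1 + y) - v| <= r / 2 -> bump_arg r v y <= 0.
  move=> h; rewrite /bump_arg argE pmulr_lle0 ?invr_gt0//.
  by have := normr_ge0 (ln (1 + y) - v); nra.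
have arg_ge1 y : r <= `|ln (1 + y) - v| -> 1 <= bump_arg r v y.
  move=> h; rewrite /bump_arg argE ler_pdivlMr// mul1r.
  by nra.
exists (fun x => psi (q x)); split.
- apply: (@test_fun_radial _ epsi (expR (v + r))) => y hy.
  apply/cutoff_ge1/arg_ge1; rewrite ler_normr lerBrDr addrC.
  rewrite -[leLHS]expRK ler_ln ?posrE ?expR_gt0//.
    by rewrite (le_trans hy)// lerDr.
  by rewrite ltr_wpDr// (le_trans (expR_ge0 _) hy).
- exact: gen_radial_continuous dpsi epsi eps.
- move=> x; split; first by rewrite cutoff_ge0 cutoff_le.
  have ri : 0 < r^-1 by rewrite invr_gt0.
  (* Either both derivatives of the cutoff vanish, and the generator with them, or [logw x] is
     within [r] of [v], which bounds the derivatives of [bump_arg]. *)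
  have [out|] := boolP ((bump_arg r v (q x) <= 0) || (1 <= bump_arg r v (q x))).
    rewrite (gen_radial dpsi dpsi1) /psi1 /psi2; have [-> ->] := cutoff12_out out.
    rewrite !mul0r addr0 mul0r addr0 normr0; apply: mulr_ge0.
      by rewrite mulr_ge0 ?growth_ge0// mulr_ge0.
    by rewrite addr_ge0 ?sqr_ge0// ltW.
  rewrite negb_or -!ltNge => /andP[_ h].
  have [h1 h2] := hB (bump_arg r v (q x)).
  have zr : `|ln (1 + q x) - v| <= r.
    by rewrite leNgt; apply/negP => /ltW /arg_ge1; rewrite leNgt h.
  have y0 := q1_gt0 x.
  have yi : (1 + q x)^-1 * (1 + q x) = 1 by rewrite mulVf// gt_eqF.
  have yi0 : 0 <= (1 + q x)^-1 by rewrite invr_ge0 ltW.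
  have r2i0 : 0 <= (r ^+ 2)^-1 by rewrite invr_ge0 ltW.
  have g1 : `|bump_arg1 r v (q x)| * (1 + q x) <= 8 * r^-1.
    rewrite /bump_arg1 !normrM (ger0_norm yi0).
    rewrite -[leLHS]mulrA yi mulr1 (@ger0_norm _ 8)// (ger0_norm r2i0).
    have -> : 8 * r^-1 = 8 / r ^+ 2 * r by field; rewrite gt_eqF.
    by rewrite ler_wpM2l// mulr_ge0.
  have g2 : `|bump_arg2 r v (q x)| * (1 + q x) ^+ 2 <= 8 * r^-1 ^+ 2 + 8 * r^-1.
    rewrite /bump_arg2 normrM (@ger0_norm _ ((1 + q x)^-1 ^+ 2)) ?sqr_ge0//.
    rewrite -[leLHS]mulrA -exprMn yi expr1n mulr1 !normrM (@ger0_norm _ 8)// (ger0_norm r2i0).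
    have -> : 8 * r^-1 ^+ 2 + 8 * r^-1 = 8 / r ^+ 2 * (1 + r) by field; rewrite gt_eqF.
    rewrite ler_wpM2l ?mulr_ge0//.
    by apply: (le_trans (ler_normB _ _)); rewrite normr1 lerD2l.
  have -> : growth * (80 * B) * (r^-1 + r^-1 ^+ 2)
    = growth * (B * (8 * r^-1) + (B * (8 * r^-1) ^+ 2 + B * (8 * r^-1 ^+ 2 + 8 * r^-1))
      + B * (64 * r^-1 + 8 * r^-1 ^+ 2)) by ring.
  apply: (@le_trans _ _ (growth * (B * (8 * r^-1) +
     (B * (8 * r^-1) ^+ 2 + B * (8 * r^-1 ^+ 2 + 8 * r^-1))))); last first.
    rewrite ler_wpM2l ?growth_ge0// lerDl mulr_ge0// addr_ge0// mulr_ge0 ?sqr_ge0//.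
    by rewrite ltW.
  apply: (gen_radial_norm_le dpsi dpsi1).
    by rewrite /psi1 normrM -mulrA ler_pM// mulr_ge0// ltW.
  rewrite /psi2; apply: (@le_trans _ _ ((`|cutoff2 (bump_arg r v (q x)) * bump_arg1 r v (q x) ^+ 2|
      + `|cutoff1 (bump_arg r v (q x)) * bump_arg2 r v (q x)|) * (1 + q x) ^+ 2)).
    by rewrite ler_wpM2r ?sqr_ge0// ler_normD.
  rewrite mulrDl (normrM (cutoff2 _)) (normrM (cutoff1 _)) -2!mulrA.
  apply: lerD; apply: ler_pM => //.
  + by rewrite mulr_ge0 ?sqr_ge0.
  + by rewrite normrX -exprMn ler_pXn2r ?nnegrE ?mulr_ge0// ltW.
  + by rewrite mulr_ge0 ?sqr_ge0.
- move=> x /arg_le0 h; split; first exact: cutoff_le0.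
  rewrite (gen_radial dpsi dpsi1) /psi1 /psi2.
  have [|-> ->] := @cutoff12_out _ (bump_arg r v (q x)); first by rewrite h.
  by rewrite !mul0r addr0 mul0r addr0.
- by move=> x /arg_ge1; exact: cutoff_ge1.
Qed.


(** The potential is [exp (- 1 / u)] with [u = (1 - q / rho) / 2]. The halving keeps [u <= 1 / 2],
    where this function of [u] is convex, so the bracket term has a favourable sign and only the
    drift is left to estimate. Compact support confines the gain to [q < rho / 2]; [C] and [m] do
    not depend on [rho]. *)
Lemma confining_gen : exists2 C, 0 <= C & exists2 m, 0 < m &
  forall eps M rho : R, C <= M -> 0 < rho -> exists f : 'rV[R]_N -> R,
  [/\ test_fun f, continuous (gen a kappa eps lam delta b f),
    forall x, 0 <= f x <= 1,
    exists D, forall x, `|gen a kappa eps lam delta b f x| <= D &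
    forall x, - gen a kappa eps lam delta b f x <=
      (2 * rho)^-1 * (C - m * M * (M < q x < rho / 2)%R%:R)].
Proof.
have [B1 B10 h1] := @flatexp_bounded R (dflat 1).
have [B2 B20 h2] := @flatexp_bounded R (dflat (dflat 1)).
have A0 := wtmass_ge0.
have d1E : dflat 1 = 'X^2 :> {poly R} by rewrite /dflat derivC subr0 mulr1.
have E1E (y : R) : 0 < y -> flatexp (dflat 1) y = y^-1 ^+ 2 * expR (- y^-1).
  by move=> y0; rewrite flatexp_gt0// d1E hornerXn.
have E1_ge0 (y : R) : 0 <= flatexp (dflat 1) y.
  have [y0|y0] := ltP 0 y; first by rewrite E1E// mulr_ge0 ?sqr_ge0 ?expR_ge0.
  by rewrite flatexp_le0.
have E2_ge0 (y : R) : y <= 1 / 2 -> 0 <= flatexp (dflat (dflat 1)) y.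
  have [y0 y2|y0 _] := ltP 0 y; last by rewrite flatexp_le0.
  rewrite flatexp_gt0// d1E /dflat derivXn /= !hornerE mulr_ge0 ?expR_ge0//.
  have : 2 <= y^-1 by rewrite -[2]invrK lef_pV2 ?posrE//; lra.
  by move=> s2; rewrite mulr_ge0 ?sqr_ge0//; nra.
(* The first summand forces [wtmass <= M], so that the drift is at most [- M] where [M < q]; the
   second bounds the contribution of the drift everywhere else. *)
exists (wtmass + B1 * wtmass); first by rewrite addr_ge0// mulr_ge0.
(* For [q < rho / 2] the inverse of [u] lies between [2] and [4], where [y ^ 2 exp (- y)] is at
   least [2 ^ 2 exp (- 4)]. *)
exists (4 * expR (-4)); first by rewrite mulr_gt0 ?expR_gt0.
move=> eps M rho CM rho0.
have AM : wtmass <= M by have := mulr_ge0 B10 A0; lra.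
pose u (y : R) := (1 - y / rho) / 2.
pose psi y := flatexp 1 (u y).
pose psi1 y := flatexp (dflat 1) (u y) * (- (2 * rho)^-1).
pose psi2 y := flatexp (dflat (dflat 1)) (u y) * (2 * rho)^-1 ^+ 2.
have rn0 : rho != 0 by rewrite gt_eqF.
have ri : 0 < (2 * rho)^-1 by rewrite invr_gt0 mulr_gt0.
have du (y : R) : is_derive y 1 u (- (2 * rho)^-1).
  by apply: is_derive_eq; rewrite /GRing.scale /=; field.
have dpsi (y : R) : 0 <= y -> is_derive y 1 psi (psi1 y).
  by move=> _; exact: (@is_derive1_comp _ _ u _ _ _ (is_derive_flatexp _ _) (du y)).
have dpsi1 (y : R) : 0 <= y -> is_derive y 1 psi1 (psi2 y).
  move=> _.
  have d1 := @is_derive1_comp _ _ u _ _ _ (is_derive_flatexp (dflat 1) _) (du y).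
  apply: (@is_derive_eq _ _ _ _ _ _ _ _ (is_deriveM d1
    (is_derive_cst (- (2 * rho)^-1) y 1))).
  by rewrite /psi2 scaler0 add0r /GRing.scale /=; ring.
have epsi : elementary (fun x => psi (q x)).
  apply: elem_flatexp; apply: elemM; last exact: elem_cst.
  apply: elemD; first exact: elem_cst.
  under [fun _ => _]funext do rewrite -mulrN.
  by apply: elemM; [exact: elementary_wsq|exact: elem_cst].
have u_le0 y : rho <= y -> u y <= 0.
  by move=> h; rewrite /u pmulr_lle0// subr_le0 ler_pdivlMr// mul1r.
have u_le y : 0 <= y -> u y <= 1 / 2.
  by move=> h; rewrite /u ler_pM2r// gerBl divr_ge0// ltW.
exists (fun x => psi (q x)); split.
- by apply: (@test_fun_radial _ epsi rho) => y /u_le0; exact: flatexp_le0.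
- exact: gen_radial_continuous dpsi epsi eps.
- move=> x; rewrite flatexp_ge0 /=.
  apply: (@le_trans _ _ (flatexp 1 1)).
    by apply: flatexp_le; have := u_le _ (wsq_ge0 wt_ge0 x); lra.
  by rewrite flatexp1 expR_le1; lra.
- exists (growth * (B1 * (2 * rho)^-1 * (1 + rho)
     + B2 * (2 * rho)^-1 ^+ 2 * (1 + rho) ^+ 2)) => x.
  have q0 := wsq_ge0 wt_ge0 x.
  have bnd (F C K : R) (p : nat) : 0 <= C -> 0 <= K -> (rho <= q x -> F = 0) -> `|F| <= C ->
      `|F| * K * (1 + q x) ^+ p <= C * K * (1 + rho) ^+ p.
    move=> C0 K0 F0 FC; have [rq|qr] := leP rho (q x).
      rewrite F0// normr0 !mul0r mulr_ge0 ?mulr_ge0// exprn_ge0//; lra.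
    rewrite ler_pM ?mulr_ge0 ?exprn_ge0//; [lra|by rewrite ler_wpM2r|].
    by rewrite lerXn2r ?nnegrE; lra.
  apply: (gen_radial_norm_le dpsi dpsi1).
    rewrite /psi1 normrM normrN (ger0_norm (ltW ri)).
    have := @bnd (flatexp (dflat 1) (u (q x))) B1 (2 * rho)^-1 1%N; rewrite !expr1.
    by apply => //; [exact: ltW|move=> /u_le0; exact: flatexp_le0].
  rewrite /psi2 normrM (ger0_norm (sqr_ge0 _)).
  by apply: bnd => //; [exact: sqr_ge0|move=> /u_le0; exact: flatexp_le0].
- move=> x; have q0 := wsq_ge0 wt_ge0 x.
  rewrite (gen_radial dpsi dpsi1) opprD.
  have p2 : 0 <= psi2 (q x) * carre x.
    rewrite mulr_ge0 ?carre_ge0// mulr_ge0 ?sqr_ge0//.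
    exact/E2_ge0/u_le.
  apply: (@le_trans _ _ (- (psi1 (q x) * drift x))); first by rewrite gerBl.
  have -> : - (psi1 (q x) * drift x) = (2 * rho)^-1 * (flatexp (dflat 1) (u (q x)) * drift x).
    by rewrite /psi1; ring.
  rewrite ler_pM2l//.
  have e0 := E1_ge0 (u (q x)); have e1 := le_trans (ler_norm _) (h1 (u (q x))).
  apply: (le_trans (ler_wpM2l e0 (drift_le x))).
  have [/andP[Mq qr]|_] := boolP (M < q x < rho / 2); last first.
    rewrite mulr0 subr0; have := ler_wpM2r A0 e1; have := mulr_ge0 e0 q0; lra.
  rewrite mulr1.
  have m0 : 4 * expR (-4) <= flatexp (dflat 1) (u (q x)).
    have u1 : 1 / 4 <= u (q x).
      have : q x / rho <= 1 / 2 by rewrite ler_pdivrMr//; lra.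
      by rewrite /u; lra.
    have u2 := u_le _ q0.
    have u0 : 0 < u (q x) by lra.
    have s1 : (u (q x))^-1 <= 4 by rewrite -[4]invrK lef_pV2 ?posrE ?invr_gt0//; lra.
    have s2 : 2 <= (u (q x))^-1 by rewrite -[2]invrK lef_pV2 ?posrE ?invr_gt0//; lra.
    rewrite E1E//; apply: ler_pM => //; rewrite ?expR_ge0//; first by nra.
    by rewrite ler_expR lerN2.
  have M0 : 0 <= M by lra.
  have : flatexp (dflat 1) (u (q x)) * (wtmass - 2 * q x) <= flatexp (dflat 1) (u (q x)) * - M.
    by rewrite ler_wpM2l//; lra.
  have := ler_wpM2r M0 m0; have := mulr_ge0 B10 A0; lra.
Qed.

End GenRadial.

(** * The martingale problem *)

Section Observables.
Context {R : realType} {N : nat} d (T : measurableType d) (X : R -> T -> 'rV[R]_N).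
Hypothesis Xcont : cont_process X.
Implicit Types g : 'rV[R]_N -> R.

Lemma continuous_path w : continuous (fun t : R => X (Num.max t 0) w).
Proof.
move=> t; have [_ /(_ w)/subspace_continuousP/= Xc] := Xcont.
have t0 : `[0, +oo[%classic (Num.max t 0).
  by rewrite /= in_itv/= andbT le_max lexx orbT.
move=> A /(Xc _ t0) h.
have {}h : \forall s \near Num.max t 0, `[0, +oo[%classic s -> A (X s w) := h.
have mc : {for t, continuous (fun t : R => Num.max t 0)}.
  have c0 : {for t, continuous (cst 0 : R -> R^o)} by exact: cvg_cst.
  have ci : {for t, continuous (id : R -> R^o)} by exact: cvg_id.
  exact: (continuous_max ci c0).
have k : \forall s \near t, `[0, +oo[%classic (Num.max s 0) -> A (X (Num.max s 0) w).
  exact: (mc _ h).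
suff : \forall s \near t, A (X (Num.max s 0) w) by [].
apply: filterS k => s /=; apply.
by rewrite in_itv/= andbT le_max lexx orbT.
Qed.

Lemma measurable_obs g t : continuous g -> measurable_fun setT (fun w => g (X t w)).
Proof.
move=> gc; apply: (measurability _ (RGenOInfty.measurableE R)) => //.
move=> /= _ [_ [a ->] <-]; rewrite setTI.
have [mX _] := Xcont.
rewrite (_ : _ @^-1` _ = X t @^-1` (g @^-1` `]a, +oo[)) //.
by apply: mX; apply: open_comp => // ? _; exact: gc.
Qed.

Let grid (k : nat) (u : R) : R :=
  (Num.truncn (Num.max u 0 * k.+1%:R))%:R / k.+1%:R.

Let grid_cvg u : grid k u @[k --> \oo] --> Num.max u 0.
Proof.
apply/cvgrPdist_le => _/posnumP[e]; near=> k.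
have u0 : 0 <= Num.max u 0 * k.+1%:R by rewrite mulr_ge0// le_max lexx orbT.
have /andP[h1 h2] := truncn_itv u0.
have k0 : 0 < k.+1%:R :> R by [].
have ke : k.+1%:R^-1 <= e%:num.
  by apply: ltW; near: k; exact: near_infty_natSinv_lt.
have -> : Num.max u 0 - grid k u =
    (Num.max u 0 * k.+1%:R - (Num.truncn (Num.max u 0 * k.+1%:R))%:R) / k.+1%:R.
  by rewrite /grid; field.
rewrite normrM normfV (@ger0_norm _ k.+1%:R)//; apply: le_trans ke.
rewrite ler_pdivrMr// mulVf ?gt_eqF//.
by rewrite ger0_norm ?subr_ge0// lerBlDl (le_trans (ltW h2))// -natr1 addrC.
Unshelve. all: by end_near. Qed.

(* Approximate the time variable by the grid of mesh [1/(k+1)]: the resulting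
   maps are jointly measurable as they are constant in time on each cell. *)
Lemma measurable_obs_joint g : continuous g ->
  measurable_fun setT (fun p : R * T => g (X (Num.max p.1 0) p.2)).
Proof.
move=> gc.
apply: (@measurable_fun_cvg _ _ _ _ (fun k (p : R * T) => g (X (grid k p.1) p.2))).
- move=> k _ B mB; rewrite setTI.
  pose I (m : nat) := [set u : R | Num.truncn (Num.max u 0 * k.+1%:R) = m].
  rewrite (_ : _ @^-1` B = \bigcup_m (I m `*`
      ((fun w => g (X (m%:R / k.+1%:R) w)) @^-1` B))); last first.
    apply/seteqP; split => [[u w] /= h|[u w] [m _ [/= <-]]//].
    by exists (Num.truncn (Num.max u 0 * k.+1%:R)).
  apply: bigcupT_measurable => m; apply: measurableX; last first.
    by rewrite -[X in measurable X]setTI; exact: (measurable_obs _ gc).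
  have mm : measurable_fun setT (fun u : R => Num.max u 0 * k.+1%:R).
    apply: measurable_funM => //; exact: measurable_maxr.
  rewrite (_ : I m = setT `&` (fun u : R => Num.max u 0 * k.+1%:R) @^-1` `[m%:R, m.+1%:R[).
    exact: mm.
  apply/seteqP; split => u /=; rewrite in_itv/=.
    by move=> <-; split => //; apply: truncn_itv; rewrite mulr_ge0// le_max lexx orbT.
  by move=> [_ h]; apply: truncn_def.
- move=> [u w] _ /=.
  have gX : {for Num.max u 0, continuous (fun t : R => g (X (Num.max t 0) w))}.
    by apply: continuous_comp; [exact: continuous_path|exact: gc].
  have := @cvg_comp _ _ _ _ _ _ _ _ (@grid_cvg u) gX.
  rewrite /= (@max_l _ _ (Num.max u 0) 0) ?le_max ?lexx ?orbT//.
  apply: cvg_trans; apply: near_eq_cvg; near=> k => /=.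
  by rewrite max_l// /grid divr_ge0.
Unshelve. all: by end_near. Qed.

Lemma nat_filt_measurable s A : nat_filt X s A -> measurable A.
Proof.
apply: smallest_sub; first exact: sigma_algebra_measurable.
move=> _ [u] [V] [_ _ oV ->]; by have [mX _] := Xcont; exact: mX.
Qed.

Variable P : probability T R.

Lemma integrable_obs A g t D : measurable A -> continuous g ->
  (forall x, `|g x| <= D) -> P.-integrable A (fun w => (g (X t w))%:E).
Proof.
move=> mA gc gD; apply: measurable_bounded_integrable => //.
- by rewrite (le_lt_trans (probability_le1 _ mA))// ltry.
- by apply: measurable_funTS; exact: measurable_obs.
- exists D; split; first exact: num_real.
  by move=> M DM w _ /=; rewrite (le_trans (gD _))// ltW.
Qed.

(** Fubini on [[s, t]] times [A] moves the expectation inside the time integral of the martingale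
    identity, so a lower bound on the mean of [L f] at each fixed time is enough. *)
Lemma MP_increment_le L f s t A (F D gam : R) :
  solves_MP L X P -> test_fun f -> continuous (L f) ->
  (forall x, `|f x| <= F) -> (forall x, `|L f x| <= D) ->
  0 <= s -> s <= t -> nat_filt X s A ->
  (forall u, s <= u <= t -> ((- gam)%:E <= \int[P]_(w in A) (L f (X u w))%:E)%E) ->
  (\int[P]_(w in A) (f (X s w) - f (X t w))%:E <= ((t - s) * gam)%:E)%E.
Proof.
move=> mp tf Lc fF LD s0 st nA hgam.
have mA := nat_filt_measurable nA.
have fc : continuous f.
  move=> x; apply: differentiable_continuous; exact: (tf.1 [::] x).
pose mu := @lebesgue_measure R.
pose I := `[s, t]%classic : set R.
have mI : measurable I by exact: measurable_itv.
have muI : mu I = (t - s)%:E.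
  rewrite /mu /I lebesgue_measure_itv/= lte_fin.
  case: ifPn => [_|]; first by rewrite EFinB.
  rewrite -leNgt => ts; have -> : t = s by apply/le_anti; rewrite ts st.
  by rewrite subrr.
pose Y (p : R * T) := L f (X (Num.max p.1 0) p.2).
have mY : measurable_fun setT Y by exact: measurable_obs_joint.
have YE u w : I u -> Y (u, w) = L f (X u w).
  rewrite /I /Y /= in_itv/= => /andP[su _].
  by rewrite max_l// (le_trans s0).
(* Extension by [0] lets Fubini be applied on the whole product; [int_u] and [int_w] restore the
   restricted integrals. *)
pose G := (EFin \o Y) \_ (I `*` A).
have iG : (mu \x P)%E.-integrable setT G.
  have mIA := measurableX mI mA.
  apply: (iffLR (@integrable_mkcond _ _ _ (mu \x P)%E _ (EFin \o Y) mIA)).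
  apply: measurable_bounded_integrable.
  - exact: measurableX.
  - rewrite [X in (X < _)%E](_ : _ = (t - s)%:E * P A)%E; last first.
      by rewrite -muI; exact: product_measure1E.
    apply: lte_mul_pinfty => //.
      by rewrite lee_fin subr_ge0.
    by rewrite (le_lt_trans (probability_le1 _ mA))// ltry.
  - exact: measurable_funTS.
  - exists D; split; first exact: num_real.
    by move=> M DM w _ /=; rewrite (le_trans (LD _))// ltW.
have GE u w : G (u, w) = if (u \in I) && (w \in A) then (L f (X u w))%:E else 0%E.
  rewrite /G patchE; have -> : ((u, w) \in I `*` A) = (u \in I) && (w \in A).
    by rewrite in_setX.
  by case: ifPn => // /andP[uI _] /=; rewrite YE//; exact: set_mem.
have int_u u : (\int[P]_w G (u, w) =
    ((fun u => \int[P]_(w in A) (L f (X u w))%:E) \_ I) u)%E.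
  rewrite patchE; case: ifPn => uI.
    by rewrite [RHS]integral_mkcond; apply: eq_integral => w _; rewrite GE uI patchE.
  by apply: integral0_eq => w _; rewrite GE (negbTE uI).
have int_w w : (\int[mu]_u G (u, w) =
    ((fun w => \int[mu]_(u in I) (L f (X u w))%:E) \_ A) w)%E.
  rewrite patchE; case: ifPn => wA.
    rewrite [RHS]integral_mkcond; apply: eq_integral => u _.
    by rewrite GE wA patchE andbT.
  by apply: integral0_eq => u _; rewrite GE (negbTE wA) andbF.
have FubG := Fubini iG.
have mG := measurable_fubini_G iG.
have Yu_int w : mu.-integrable I (fun u => (L f (X u w))%:E).
  apply: measurable_bounded_integrable => //.
  - by rewrite [X in (X < _)%E](_ : _ = mu I)// muI ltry.
  - apply: (@eq_measurable_fun _ _ _ _ _ (fun u : R => L f (X (Num.max u 0) w))).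
      by move=> u /set_mem uI; rewrite -(YE u w uI).
    apply: measurable_funTS; apply: continuous_measurable_fun => u.
    by apply: continuous_comp; [exact: continuous_path|exact: Lc].
  - exists D; split; first exact: num_real.
    by move=> M DM u _ /=; rewrite (le_trans (LD _))// ltW.
pose J w := Rintegral mu I (fun u => L f (X u w)).
have JE w : (J w)%:E = (\int[mu]_(u in I) (L f (X u w))%:E)%E.
  by rewrite /J /Rintegral fineK//; exact: integrable_fin_num.
have JD w : `|J w| <= D * (t - s).
  rewrite -lee_fin -abse_EFin JE.
  apply: (le_trans (le_abse_integral mu mI (measurable_int _ (Yu_int w)))).
  rewrite EFinM -muI -(integral_cst mu mI D%:E).
  apply: ge0_le_integral => //.
  - by apply: measurableT_comp => //; exact: measurable_int (Yu_int w).
  - by move=> u _ /=; rewrite lee_fin.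
have iJ : P.-integrable A (EFin \o J).
  apply: measurable_bounded_integrable => //.
  - by rewrite (le_lt_trans (probability_le1 _ mA))// ltry.
  - apply/measurable_EFinP.
    apply: (@eq_measurable_fun _ _ _ _ _ (fubini_G mu G)).
      by move=> w wA; rewrite /fubini_G int_w patchE wA -JE.
    exact: measurable_funTS.
  - exists (D * (t - s)); split; first exact: num_real.
    by move=> M DM w _ /=; rewrite (le_trans (JD _))// ltW.
have ift : P.-integrable A (EFin \o (fun w => f (X t w))).
  exact: (integrable_obs t mA fc fF).
have ifs : P.-integrable A (EFin \o (fun w => f (X s w))).
  exact: (integrable_obs s mA fc fF).
have intJ : ((- ((t - s) * gam))%:E <= \int[P]_(w in A) (J w)%:E)%E.
  have -> : (\int[P]_(w in A) (J w)%:E =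
             \int[mu]_(u in I) \int[P]_(w in A) (L f (X u w))%:E)%E.
    rewrite [LHS]integral_mkcond [RHS]integral_mkcond.
    under [RHS]eq_integral do rewrite -int_u.
    rewrite FubG; apply: eq_integral => w _.
    by rewrite int_w !patchE JE.
  have -> : (- ((t - s) * gam))%:E = (\int[mu]_(u in I) cst (- gam)%:E u)%E.
    by rewrite integral_cst// -[X in (_ * X)%E]/(mu I) muI -EFinM; congr (_%:E); ring.
  apply: le_integral => //.
  - apply: measurable_bounded_integrable => //.
    + by rewrite [X in (X < _)%E](_ : _ = mu I)// muI ltry.
    + by exists `|gam|; split; [exact: num_real|move=> M hM u _ /=; rewrite normrN ltW].
  - apply: (iffRL (@integrable_mkcond _ _ _ mu _ _ mI)).
    apply: eq_integrable (integrable_fubini_F iG) => //.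
    by move=> u _; rewrite /fubini_F int_u.
  - by move=> u /set_mem; rewrite /I /= in_itv/=; exact: hgam.
have := mp f tf s t A s0 st nA.
have -> : (\int[P]_(w in A) (f (X t w) - f (X s w) - Rintegral mu I (fun u => L f (X u w)))%:E
    = \int[P]_(w in A) (f (X t w))%:E - \int[P]_(w in A) (f (X s w))%:E
    - \int[P]_(w in A) (J w)%:E)%E.
  rewrite -(integralB mA ift ifs) -integralB//; last exact: integrableB.
have -> : (\int[P]_(w in A) (f (X s w) - f (X t w))%:E
  = \int[P]_(w in A) (f (X s w))%:E - \int[P]_(w in A) (f (X t w))%:E)%E.
  by rewrite -(integralB mA ifs ift).
move: intJ; rewrite -/(J _).
have := integrable_fin_num mA ift; have := integrable_fin_num mA ifs.
have := integrable_fin_num mA iJ => /=.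
move=> /fineK <- /fineK <- /fineK <-.
rewrite -!EFinB !lee_fin => h [h'].
lra.
Qed.

End Observables.

(** * Tail estimates *)

Section ProbEstimates.
Context {R : realType} {N : nat} d (T : measurableType d) (X : R -> T -> 'rV[R]_N).
Hypothesis Xcont : cont_process X.
Variable P : probability T R.

Local Notation pr E := (fine (P E)).

Lemma prE E : measurable E -> P E = (pr E)%:E.
Proof. by move=> mE; rewrite fineK// fin_num_measure. Qed.

Lemma pr_le A B : measurable A -> measurable B -> A `<=` B -> pr A <= pr B.
Proof.
by move=> mA mB AB; rewrite -lee_fin -!prE//; apply: le_measure; rewrite ?inE.
Qed.

Lemma integrable_aff_indic A E (al be : R) : measurable A -> measurable E ->
  P.-integrable A (fun w => (al + be * \1_E w)%:E).
Proof.
move=> mA mE; apply: (@measurable_bounded_integrable _ _ _ P (fun w => al + be * \1_E w)) => //.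
- by rewrite (le_lt_trans (probability_le1 _ mA))// ltry.
- apply: measurable_funD => //; apply: measurable_funM => //.
- exists (`|al| + `|be|); split; first exact: num_real.
  move=> M hM w _ /=; rewrite (le_trans (ler_normD _ _))// (le_trans _ (ltW hM))// lerD2l.
  by rewrite normrM ler_piMr// indicE; case: (w \in E); rewrite ?normr1 ?normr0.
Qed.

(** All pointwise minorants used below are a constant plus a multiple of one indicator, so that
    integral bounds turn into inequalities between probabilities. *)
Lemma integral_aff_indic A E (al be : R) : measurable A -> measurable E ->
  (\int[P]_(w in A) (al + be * \1_E w)%:E = (al * pr A + be * pr (A `&` E))%:E)%E.
Proof.
move=> mA mE.
have i1 := @integrable_aff_indic A E al 0 mA mE.
have i2 := @integrable_aff_indic A E 0 be mA mE.
transitivity (\int[P]_(w in A) ((al + 0 * \1_E w)%:E + (0 + be * \1_E w)%:E))%E.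
  by apply: eq_integral => w _; rewrite -EFinD; congr (_%:E); ring.
rewrite integralD// EFinD; congr (_ + _)%E.
  under eq_integral do rewrite mul0r addr0.
  by rewrite (integral_cst P mA al%:E) EFinM -prE.
under eq_integral do rewrite add0r EFinM.
rewrite integralZl//; last first.
  have := @integrable_aff_indic A E 0 1 mA mE.
  by apply: eq_integrable => // w _; rewrite add0r mul1r.
by rewrite integral_indic// setIC EFinM -prE//; exact: measurableI.
Qed.

Lemma integral_ge_aff A E (al be D : R) (g : 'rV[R]_N -> R) u :
  measurable A -> measurable E -> continuous g -> (forall x, `|g x| <= D) ->
  (forall w, A w -> al + be * \1_E w <= g (X u w)) ->
  ((al * pr A + be * pr (A `&` E))%:E <= \int[P]_(w in A) (g (X u w))%:E)%E.
Proof.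
move=> mA mE gc gD h; rewrite -integral_aff_indic//.
apply: le_integral => //; first exact: integrable_aff_indic.
  exact: integrable_obs gD.
by move=> w /set_mem /h; rewrite lee_fin.
Qed.

Lemma measurable_level (g : 'rV[R]_N -> R) t (B : set R) :
  continuous g -> measurable B -> measurable [set w | B (g (X t w))].
Proof.
move=> gc mB; rewrite -[X in measurable X]setTI.
exact: (measurable_obs Xcont t gc).
Qed.

Variable L : ('rV[R]_N -> R) -> 'rV[R]_N -> R.
Hypothesis mp : solves_MP L X P.

Lemma MP_real_bound f s t A E (F D al be gam : R) :
  test_fun f -> continuous (L f) ->
  (forall x, `|f x| <= F) -> (forall x, `|L f x| <= D) ->
  0 <= s -> s <= t -> nat_filt X s A ->
  (forall u, s <= u <= t -> ((- gam)%:E <= \int[P]_(w in A) (L f (X u w))%:E)%E) ->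
  measurable E ->
  (forall w, A w -> al + be * \1_E w <= f (X s w) - f (X t w)) ->
  al * pr A + be * pr (A `&` E) <= (t - s) * gam.
Proof.
move=> tf Lc fF LD s0 st nA hg mE h.
have mA := nat_filt_measurable Xcont nA.
have fc : continuous f.
  by move=> x; apply: differentiable_continuous; exact: (tf.1 [::] x).
rewrite -lee_fin -integral_aff_indic//.
apply: le_trans (MP_increment_le Xcont mp tf Lc fF LD s0 st nA hg).
apply: le_integral => //; first exact: integrable_aff_indic.
  have := @integrableB _ _ _ _ _ mA _ _ (integrable_obs Xcont P s mA fc fF)
    (integrable_obs Xcont P t mA fc fF).
  by apply: eq_integrable.
by move=> w /set_mem /h; rewrite lee_fin.
Qed.

Section Increment.
Variables (V : 'rV[R]_N -> R) (D : R).
Hypothesis Vc : continuous V.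
Hypothesis V0 : forall x, 0 <= V x.
Hypothesis D0 : 0 <= D.
Hypothesis bump : forall r v : R, 0 < r -> exists f : 'rV[R]_N -> R,
  [/\ test_fun f, continuous (L f),
    forall x, 0 <= f x <= expR (-1) /\ `|L f x| <= D * (r^-1 + r^-1 ^+ 2),
    forall x, `|V x - v| <= r / 2 -> f x = expR (-1) /\ L f x = 0 &
    forall x, r <= `|V x - v| -> f x = 0].

Definition away r v u : set T := [set w | r < `|V (X u w) - v|].

Lemma measurable_away r v u : measurable (away r v u).
Proof.
have gc : continuous (fun x => `|V x - v|).
  move=> x; apply: (@continuous_comp _ _ _ (fun x => V x - v) Num.norm).
    by apply: (@continuousB _ _ _ V (cst v)); [exact: Vc|exact: cst_continuous].
  exact: norm_continuous.
have := @measurable_level _ u `]r, +oo[%classic gc (measurable_itv _).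
by congr measurable; apply/seteqP; split => w /=; rewrite in_itv/= andbT.
Qed.

(** On [A] the bump sits on its plateau at time [s], and it has fallen to [0] if the path is [r]
    away at time [t]. Its generator vanishes on the plateau, so only paths already [r / 2] away feed
    the time integral. *)
Lemma away_step r v s t A beta : 0 < r -> 0 <= s -> s <= t -> nat_filt X s A ->
  (forall w, A w -> `|V (X s w) - v| <= r / 2) ->
  (forall u, s <= u <= t -> pr (A `&` away (r / 2) v u) <= beta) ->
  pr (A `&` away r v t) <= expR 1 * D * (r^-1 + r^-1 ^+ 2) * (t - s) * beta.
Proof.
move=> r0 s0 st nA As hb.
have [f [tf Lc hf hin hout]] := bump v r0.
have mA := nat_filt_measurable Xcont nA.
set K := D * (r^-1 + r^-1 ^+ 2) in hf *.
have K0 : 0 <= K by rewrite mulr_ge0// addr_ge0// ?sqr_ge0// invr_ge0 ltW.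
have fF x : `|f x| <= expR (-1).
  by have [/andP[f0 f1] _] := hf x; rewrite ger0_norm.
have LK x : `|L f x| <= K by have [_] := hf x.
have hg u : s <= u <= t -> ((- (K * beta))%:E <= \int[P]_(w in A) (L f (X u w))%:E)%E.
  move=> sut.
  have := @integral_ge_aff A (away (r / 2) v u) 0 (- K) K (L f) u mA (measurable_away _ _ _) Lc LK.
  move=> H; apply: le_trans (H _).
    by rewrite lee_fin mul0r add0r mulNr lerN2 ler_wpM2l// hb.
  move=> w Aw; rewrite add0r indicE; have [_|] := boolP (w \in _).
    by rewrite mulr1; have := LK (X u w); rewrite ler_norml => /andP[].
  rewrite notin_setE /away /= => /negP; rewrite -leNgt => /hin [_ ->].
  by rewrite mulr0.
have := @MP_real_bound f s t A (away r v t) _ _ 0 (expR (-1)) _ tf Lc fF LK s0 st nA hg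
  (measurable_away _ _ _).
rewrite mul0r add0r => H.
have {}H : expR (-1) * pr (A `&` away r v t) <= (t - s) * (K * beta).
  apply: H => w Aw; have [-> _] := hin _ (As w Aw).
  have [/andP[f0 f1] _] := hf (X t w).
  rewrite add0r indicE; have [|_] := boolP (w \in _); last by rewrite mulr0 subr_ge0.
  by rewrite inE /away /= => /ltW /hout ->; rewrite mulr1 subr0.
have : expR 1 * (expR (-1) * pr (A `&` away r v t)) <= expR 1 * ((t - s) * (K * beta)).
  by rewrite ler_wpM2l// expR_ge0.
rewrite mulrA -expRD subrr expR0 mul1r => /le_trans; apply.
by rewrite le_eqVlt; apply/orP; left; apply/eqP; rewrite /K; ring.
Qed.

(** Each application of [away_step] contributes [expR 1 * D]; the [4] is the cost of replacing [r]
    by [r / 2] in [r^-1 + r^-1 ^+ 2]. *)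
Definition incr_cst : R := 4 * (expR 1 * D) ^+ 2.

Lemma incr_cst_ge0 : 0 <= incr_cst.
Proof. by apply: mulr_ge0 => //; exact: sqr_ge0. Qed.

(** [away_step] at radius [r] is fed by itself at radius [r / 2], where [beta] is the trivial
    [pr A]. Starting within [r / 4] of [v] is what the inner application demands. *)
Lemma away_twice r v s t A : 0 < r -> 0 <= s -> s <= t -> nat_filt X s A ->
  (forall w, A w -> `|V (X s w) - v| <= r / 4) ->
  pr (A `&` away r v t) <= incr_cst * (r^-1 + r^-1 ^+ 2) ^+ 2 * (t - s) ^+ 2 * pr A.
Proof.
move=> r0 s0 st nA As.
have mA := nat_filt_measurable Xcont nA.
have ri : 0 < r^-1 by rewrite invr_gt0.
have c0 : 0 <= r^-1 + r^-1 ^+ 2 by rewrite addr_ge0 ?sqr_ge0 ?ltW.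
have eD : 0 <= expR 1 * D by rewrite mulr_ge0 ?expR_ge0.
have pA : 0 <= pr A by exact: fine_ge0.
have st0 : 0 <= t - s by rewrite subr_ge0.
have r2 : 0 < r / 2 by rewrite divr_gt0.
have := @away_step r v s t A (expR 1 * D * (4 * (r^-1 + r^-1 ^+ 2)) * (t - s) * pr A)
  r0 s0 st nA.
move=> H; apply: (le_trans (H _ _)).
- by move=> w Aw; apply: (le_trans (As w Aw)); lra.
- move=> u /andP[su ut].
  apply: (le_trans (@away_step (r / 2) v s u A (pr A) r2 s0 su nA _ _)).
  + by move=> w Aw; apply: (le_trans (As w Aw)); lra.
  + move=> x _; apply: pr_le => //.
    by apply: measurableI => //; exact: measurable_away.
  + rewrite ler_wpM2r// ler_pM//.
    * by rewrite mulr_ge0// invfM invrK addr_ge0 ?sqr_ge0// mulr_ge0// ltW.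
    * by rewrite subr_ge0.
    * rewrite ler_wpM2l// invfM invrK.
      by have := sqr_ge0 r^-1; nra.
    * by rewrite lerD2r.
- by rewrite le_eqVlt; apply/orP; left; apply/eqP; rewrite /incr_cst; ring.
Qed.

(** The slices [A i] of width [r / 4] replace the random centre [V (X s w)] by the number
    [i%:R * th]. A move by more than [2 * r] from the true centre is still one by more than [r] from
    the nearby deterministic one, and the factors [P (A i)] sum to at most [1]. *)
Lemma incr_tail r s t : 0 < r -> 0 <= s -> s <= t ->
  pr [set w | 2 * r < `|V (X t w) - V (X s w)|]
    <= incr_cst * (r^-1 + r^-1 ^+ 2) ^+ 2 * (t - s) ^+ 2.
Proof.
move=> r0 s0 st.
pose th := r / 4.
have th0 : 0 < th by rewrite divr_gt0.
pose B (i : nat) : set T := X s @^-1` (V @^-1` `]-oo, (i%:R * th)[).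
pose A i := B i.+1 `\` B i.
have nA i : nat_filt X s (A i).
  have nB j : nat_filt X s (B j).
    apply: sub_sigma_algebra; exists s, (V @^-1` `]-oo, (j%:R * th)[); split => //.
    by apply: open_comp => // ? _; exact: Vc.
  exact: (@measurableD _ (g_sigma_algebraType _) _ _ (nB i.+1) (nB i)).
have AP i w : A i w <-> i%:R * th <= V (X s w) < i.+1%:R * th.
  rewrite /A /B /= !in_itv/=; split => [[h1 /negP]|/andP[h1 h2]].
    by rewrite -leNgt => ->.
  by split => //; apply/negP; rewrite -leNgt.
have mA i : measurable (A i) by exact: nat_filt_measurable (nA i).
set E := [set w | _ < _]; set K := (X in _ <= X).
have K0 : 0 <= K.
  apply: mulr_ge0; last exact: sqr_ge0.
  by apply: mulr_ge0; [exact: incr_cst_ge0|exact: sqr_ge0].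
have mE : measurable E.
  have mf : measurable_fun setT (fun w => `|V (X t w) - V (X s w)|).
    by apply: measurableT_comp => //; apply: measurable_funB; exact: (measurable_obs Xcont _ Vc).
  rewrite (_ : E = setT `&` (fun w => `|V (X t w) - V (X s w)|) @^-1` `]2 * r, +oo[%classic).
    by apply: mf.
  by apply/seteqP; split => w /=; rewrite in_itv/= andbT => // -[].
have cov w : exists i, A i w.
  exists (Num.truncn (V (X s w) / th)); apply/AP.
  have v0 : 0 <= V (X s w) / th by rewrite divr_ge0// ltW.
  by have := truncn_itv v0; rewrite ler_pdivlMr// ltr_pdivrMr.
have tA : trivIset setT A.
  apply/trivIsetP => i j _ _ ij; apply/seteqP; split => // w [/AP/andP[h1 h2] /AP/andP[h3 h4]].
  have := le_lt_trans h1 h4; have := le_lt_trans h3 h2.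
  rewrite !ltr_pM2r// !ltr_nat !ltnS => ji ij'.
  by move: ij; rewrite (@anti_leq i j) ?eqxx// ij' ji.
have bnd i : (P (E `&` A i) <= K%:E * P (A i))%E.
  rewrite (prE (mA i)) -EFinM (prE (measurableI _ _ mE (mA i))) lee_fin.
  have := @away_twice r (i%:R * th) s t (A i) r0 s0 st (nA i).
  move=> H; apply: le_trans (H _).
    apply: pr_le.
    - exact: measurableI.
    - by apply: measurableI => //; exact: measurable_away.
    move=> w [Ew Aw]; split => //; rewrite /away /=.
    have /AP/andP[h1 h2] := Aw; move: Ew; rewrite /E /=.
    have : `|V (X s w) - i%:R * th| <= th.
      by rewrite ger0_norm ?subr_ge0//; move: h2; rewrite -natr1; lra.
    have := ler_distD (i%:R * th) (V (X t w)) (V (X s w)).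
    rewrite (distrC (i%:R * th)) /th => h3 h4 h5.
    move: h3 h4 h5.
    set p := `|_|; set q := `|_|; set z := `|_|.
    lra.
  move=> w /AP/andP[h1 h2]; rewrite ger0_norm ?subr_ge0//.
  by move: h2; rewrite -natr1 /th; lra.
rewrite -lee_fin -prE//.
apply: (@le_trans _ _ (\sum_(0 <= i <oo) P (E `&` A i))%E).
  apply: measure_sigma_subadditive => //.
    by move=> i; exact: measurableI.
  by move=> w Ew; have [i Ai] := cov w; exists i.
apply: (@le_trans _ _ (\sum_(0 <= i <oo) K%:E * P (A i))%E).
  by apply: lee_nneseries => i *; [exact: measure_ge0|exact: bnd].
rewrite nneseriesZl//.
have -> : (\sum_(0 <= i <oo) P (A i))%E = P (\bigcup_i A i).
  rewrite measure_bigcup//; apply: eq_eseriesl => i.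
  by rewrite in_setT.
rewrite -[leRHS]mule1; apply: lee_wpmul2l; first by rewrite lee_fin.
by apply: probability_le1; exact: bigcupT_measurable.
Qed.

End Increment.

Section InitialTail.
Variables (q : 'rV[R]_N -> R) (C m : R).
Hypothesis qc : continuous q.
Hypothesis m0 : 0 < m.
Hypothesis stat : stationary X P.
Hypothesis confining : forall M rho : R, C <= M -> 0 < rho ->
  exists f : 'rV[R]_N -> R,
  [/\ test_fun f, continuous (L f), forall x, 0 <= f x <= 1,
    exists D, forall x, `|L f x| <= D &
    forall x, - L f x <= (2 * rho)^-1 * (C - m * M * (M < q x < rho / 2)%R%:R)].

(* Run up to time [2 rho] the potential [f], which is at most [1], absorbs the
   factor [(2 rho)^-1]; stationarity makes the occupation probability constant. *)
Lemma shell_tail M rho : C <= M -> 0 < M -> 0 < rho ->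
  pr [set w | M < q (X 0 w) < rho / 2] <= (C + 1) / (m * M).
Proof.
move=> CM M0 rho0.
have [f [tf Lc f01 [D LD] hL]] := confining CM rho0.
pose O := q @^-1` `]M, (rho / 2)[.
pose S u : set T := X u @^-1` O.
have oO : open O by apply: open_comp => // ? _; exact: qc.
have mS u : measurable (S u) by have [mX _] := Xcont; exact: mX.
have SE : [set w | M < q (X 0 w) < rho / 2] = S 0.
  by apply/seteqP; split => w; rewrite /S /O /= in_itv.
rewrite SE; set p := pr (S 0).
have nT : nat_filt X 0 setT.
  by rewrite -[setT]setD0; apply: sigma_algebraCD; exact: sigma_algebra0.
have t0 : 0 <= 2 * rho by rewrite mulr_ge0// ltW.
have pT : pr setT = 1 by rewrite probability_setT.
pose gam := (2 * rho)^-1 * (C - m * M * p).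
have fF x : `|f x| <= 1 by have /andP[h0 h1] := f01 x; rewrite ger0_norm.
have hg u : 0 <= u <= 2 * rho -> ((- gam)%:E <= \int[P]_(w in setT) (L f (X u w))%:E)%E.
  move=> /andP[u0 _].
  have := @integral_ge_aff setT (S u) (- ((2 * rho)^-1 * C)) ((2 * rho)^-1 * (m * M)) D (L f) u
    measurableT (mS u) Lc LD.
  move=> H; apply: le_trans (H _).
    have -> : pr (setT `&` S u) = p by rewrite setTI /p /S (stat u0 oO).
    by rewrite lee_fin pT le_eqVlt; apply/orP; left; apply/eqP; rewrite /gam; ring.
  move=> w _; have := hL (X u w).
  have -> : \1_(S u) w = (M < q (X u w) < rho / 2)%R%:R :> R.
    rewrite indicE; congr (nat_of_bool _)%:R.
    by apply/idP/idP; rewrite inE /S /O /= in_itv.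
  lra.
(* With [E] empty, only the crude bound [-1] on the decrease of [f] is used; the information on the
   shell sits in [gam]. *)
have := @MP_real_bound f 0 (2 * rho) setT set0 1 D (-1) 0 gam tf Lc fF LD (lexx _) t0 nT hg
  measurable0.
rewrite pT mul0r addr0 mulr1 subr0 => H.
have {}H : -1 <= 2 * rho * gam.
  apply: H => w _; rewrite mul0r addr0.
  by have /andP[a0 a1] := f01 (X 0 w); have /andP[b0 b1] := f01 (X (2 * rho) w); lra.
have mM : 0 < m * M by rewrite mulr_gt0.
rewrite ler_pdivlMr//.
have E : 2 * rho * gam = C - m * M * p by rewrite /gam mulrA divff ?mul1r// mulf_neq0// gt_eqF.
by move: H; rewrite E; lra.
Qed.

(** The bound on the shell does not depend on its outer radius, which is sent to infinity along
    [k.+1%:R / 2] by monotone continuity of [P]. *)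
Lemma initial_tail M : C <= M -> 0 < M ->
  pr [set w | M < q (X 0 w)] <= (C + 1) / (m * M).
Proof.
move=> CM M0.
pose F (k : nat) := [set w | M < q (X 0 w) < k.+1%:R / 2].
have mF k : measurable (F k).
  have := @measurable_level q 0 `]M, (k.+1%:R / 2)[%classic qc (measurable_itv _).
  by congr measurable; apply/seteqP; split => w /=; rewrite in_itv.
have mU : measurable (\bigcup_k F k) by exact: bigcupT_measurable.
have -> : [set w | M < q (X 0 w)] = \bigcup_k F k.
  apply/seteqP; split => [w /= Mq|w [k _] /andP[]//].
  exists (Num.truncn (2 * q (X 0 w))) => //; apply/andP; split => //.
  have q0 : 0 <= 2 * q (X 0 w) by rewrite mulr_ge0// (le_trans (ltW M0))// ltW.
  by have /andP[_] := truncn_itv q0; lra.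
rewrite -lee_fin -prE//.
have ndF : nondecreasing_seq F.
  move=> i j ij; apply/subsetPset => w /andP[h1 h2]; apply/andP; split => //.
  by rewrite (lt_le_trans h2)// ler_pM2r// ler_nat.
have cv := @nondecreasing_cvg_mu _ _ _ P F mF mU ndF.
rewrite -(cvg_lim _ cv)//; apply: lime_le; first by apply/cvg_ex; eexists; exact: cv.
near=> k; rewrite /= prE// lee_fin; exact: shell_tail.
Unshelve. all: by end_near. Qed.

End InitialTail.
End ProbEstimates.

(** * Chaining *)

Section Chaining.
Context {R : realType}.
Implicit Types (s t : R) (V : R -> R).

(** With steps of size [decay ^+ j] at mesh [2 ^ (- j)], the bound [h ^ 2 / r ^ 4] summed over the
    mesh is of order [(decay ^ (- 4) / 2) ^ j], apart from a factor [j]. It is summable because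
    [9 / 10] exceeds [2 ^ (- 1 / 4)]. *)
Definition decay : R := 9 / 10.

Definition dyad (j k : nat) : R := k%:R / 2 ^+ j.

(** Level [j] covers [[0, j]], so this one countable family of conditions controls the path on every
    bounded interval [[0, m]], from level [m] on. *)
Definition chained (C : R) V := forall j k : nat, (k < j * 2 ^ j)%N ->
  `|V (dyad j k.+1) - V (dyad j k)| <= C * decay ^+ j.

Definition idx (t : R) (j : nat) : nat := Num.truncn (t * 2 ^+ j).

Lemma idx_itv t j : 0 <= t -> (idx t j)%:R <= t * 2 ^+ j < (idx t j).+1%:R.
Proof. by move=> t0; apply: truncn_itv; rewrite mulr_ge0. Qed.

Lemma idx_le t j (m : nat) : 0 <= t -> t <= m%:R -> (idx t j <= m * 2 ^ j)%N.
Proof.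
move=> t0 tm; have /andP[h _] := idx_itv j t0.
rewrite -(ler_nat R) (le_trans h)// natrM natrX ler_wpM2r//.
Qed.

Lemma idxS t j : 0 <= t -> idx t j.+1 = (idx t j).*2 \/ idx t j.+1 = (idx t j).*2.+1.
Proof.
move=> t0; have /andP[h1 h2] := idx_itv j t0; have /andP[h3 h4] := idx_itv j.+1 t0.
have e : t * 2 ^+ j.+1 = 2 * (t * 2 ^+ j) by rewrite exprS; ring.
have a1 : ((idx t j).*2 < (idx t j.+1).+1)%N.
  by rewrite -(ltr_nat R) -muln2 natrM; rewrite e in h4; lra.
have a2 : (idx t j.+1 < (idx t j).+1.*2)%N.
  by rewrite -(ltr_nat R) -muln2 natrM; rewrite e in h3; lra.
by move: a1 a2; clear; lia.
Qed.

Lemma dyad_double j k : dyad j.+1 k.*2 = dyad j k.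
Proof.
rewrite /dyad -muln2 natrM exprS invfM.
have h : 2 ^+ j != 0 :> R by rewrite expf_neq0.
by field.
Qed.

Lemma dyad_idx_cvg t : 0 <= t -> dyad j (idx t j) @[j --> \oo] --> t.
Proof.
move=> t0; apply/cvgrPdist_le => e e0.
have h2 : `|1 / 2 : R| < 1 by rewrite ger0_norm; lra.
have := cvg_expr h2 => /cvgr0Pnorm_le/(_ e e0); apply: filterS => j.
rewrite normrX ger0_norm; last by lra.
apply: le_trans.
have p0 : 0 < 2 ^+ j :> R by rewrite exprn_gt0.
have /andP[h1 h3] := idx_itv j t0.
have -> : t - dyad j (idx t j) = (t * 2 ^+ j - (idx t j)%:R) / 2 ^+ j.
  by rewrite /dyad; field; rewrite gt_eqF.
rewrite ger0_norm; last by apply: divr_ge0; [rewrite subr_ge0|exact: ltW].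
rewrite expr_div_n expr1n ler_pM2r ?invr_gt0//.
by move: h3; rewrite -natr1; lra.
Qed.

Variables (C : R) (V : R -> R).
Hypotheses (C0 : 0 <= C) (Vc : continuous V) (hV : chained C V).

Lemma decay_ge0 : 0 <= decay. Proof. by rewrite /decay; lra. Qed.

(** [9 = decay / (1 - decay)] sums the geometric series; keeping the exact difference makes the
    induction step an equality. *)
Lemma dyad_approx_idx (m j n : nat) t : 0 <= t -> t <= m%:R -> (m <= j)%N ->
  `|V (dyad (j + n) (idx t (j + n))) - V (dyad j (idx t j))|
     <= 9 * C * (decay ^+ j - decay ^+ (j + n)).
Proof.
move=> t0 tm mj; elim: n => [|n IH]; first by rewrite addn0 !subrr normr0 mulr0.
apply: le_trans (ler_distD (V (dyad (j + n) (idx t (j + n)))) _ _) _.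
have step : `|V (dyad (j + n.+1) (idx t (j + n.+1))) - V (dyad (j + n) (idx t (j + n)))|
    <= C * decay ^+ (j + n).+1.
  rewrite addnS; case: (idxS (j + n) t0) => e; rewrite e.
    by rewrite dyad_double subrr normr0 mulr_ge0// exprn_ge0// decay_ge0.
  rewrite -(dyad_double (j + n)); apply: hV.
  have := idx_le (j + n).+1 t0 tm; rewrite e => /leq_trans; apply.
  by rewrite leq_mul2r (leq_trans mj) ?orbT// -addnS leq_addr.
rewrite addnS exprS in step *; have := lerD step IH => /le_trans; apply.
rewrite le_eqVlt; apply/orP; left; apply/eqP.
set x := decay ^+ (j + n); set y := decay ^+ j.
by rewrite /decay; field.
Qed.

Lemma dyad_approx (m j : nat) t : 0 <= t -> t <= m%:R -> (m <= j)%N ->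
  `|V t - V (dyad j (idx t j))| <= 9 * C * decay ^+ j.
Proof.
move=> t0 tm mj.
have cv : `|V (dyad i (idx t i)) - V (dyad j (idx t j))| @[i --> \oo]
    --> `|V t - V (dyad j (idx t j))|.
  have cV : V (dyad i (idx t i)) @[i --> \oo] --> V t.
    by apply: (@cvg_comp _ _ _ (fun i => dyad i (idx t i)) V); [exact: dyad_idx_cvg|exact: Vc].
  exact: (cvg_norm (cvgB cV (cvg_cst (V (dyad j (idx t j)))))).
apply: (cvgr_to_le cv).
near=> i; have ji : (j <= i)%N by near: i; exact: nbhs_infty_ge.
rewrite -(subnKC ji); apply: (le_trans (@dyad_approx_idx m j _ _ t0 tm mj)).
rewrite ler_wpM2l ?mulr_ge0// gerBl exprn_ge0// decay_ge0//.
Unshelve. all: by end_near. Qed.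

(** [19 = 9 + 1 + 9]: two approximations by level [j] points and at most one step between these,
    since they are equal or adjacent. *)
Lemma chained_modulus (m j : nat) s t : 0 <= s -> s <= m%:R -> 0 <= t -> t <= m%:R ->
  (m <= j)%N -> `|s - t| <= (2 ^+ j)^-1 -> `|V s - V t| <= 19 * C * decay ^+ j.
Proof.
wlog st : s t / s <= t.
  move=> H s0 sm t0 tm mj h; have [st|/ltW ts] := leP s t; first exact: H.
  by rewrite distrC; apply: H => //; rewrite distrC.
move=> s0 sm t0 tm mj; rewrite distrC ger0_norm ?subr_ge0// => h.
have p0 : 0 < 2 ^+ j :> R by rewrite exprn_gt0.
have h' : t * 2 ^+ j <= s * 2 ^+ j + 1.
  by move: h; rewrite -[_^-1]mul1r ler_pdivlMr//; lra.
have h1 := @dyad_approx m j s s0 sm mj; have h2 := @dyad_approx m j t t0 tm mj.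
have h3 : `|V (dyad j (idx t j)) - V (dyad j (idx s j))| <= C * decay ^+ j.
  have /andP[s1 s2] := idx_itv j s0; have /andP[t1 t2] := idx_itv j t0.
  have st2 : s * 2 ^+ j <= t * 2 ^+ j by rewrite ler_wpM2r// ltW.
  have a1 : (idx s j < (idx t j).+1)%N by rewrite -(ltr_nat R); lra.
  have a2 : (idx t j < (idx s j).+2)%N.
    by rewrite -(ltr_nat R) -addn2 natrD; move: s2; rewrite -addn1 natrD; lra.
  have [e|e] : idx t j = idx s j \/ idx t j = (idx s j).+1.
    by move: a1 a2; clear; lia.
    by rewrite e subrr normr0 mulr_ge0// exprn_ge0// decay_ge0.
  rewrite e; apply: hV; have := idx_le j t0 tm; rewrite e.
  by move=> /leq_trans; apply; rewrite leq_mul2r mj orbT.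
have h4 := ler_distD (V (dyad j (idx s j))) (V s) (V t).
have h5 := ler_distD (V (dyad j (idx t j))) (V (dyad j (idx s j))) (V t).
rewrite (distrC (V t)) in h2; rewrite (distrC (V (dyad j (idx t j)))) in h3.
lra.
Qed.

(** Walk from [0] along level [m], at most [m * 2 ^ m] steps of size at most [C], then add the
    approximation error. *)
Lemma chained_bound (m : nat) t : 0 <= t -> t <= m%:R ->
  `|V t - V 0| <= C * (m%:R * 2 ^+ m + 9).
Proof.
move=> t0 tm.
have r1 : decay ^+ m <= 1 by rewrite exprn_ile1// /decay; lra.
have rm0 : 0 <= decay ^+ m by rewrite exprn_ge0// decay_ge0.
have h1 := @dyad_approx m m t t0 tm (leqnn _).
have h2 k : (k <= m * 2 ^ m)%N -> `|V (dyad m k) - V 0| <= k%:R * C.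
  elim: k => [_|k IH km]; first by rewrite /dyad !mul0r subrr normr0.
  apply: le_trans (ler_distD (V (dyad m k)) _ _) _.
  rewrite -natr1 mulrDl mul1r addrC; apply: lerD; first exact/IH/ltnW.
  by apply: (le_trans (hV km)); rewrite ler_piMr.
have h3 := h2 _ (idx_le m t0 tm).
have h4 : (idx t m)%:R * C <= m%:R * 2 ^+ m * C.
  by rewrite ler_wpM2r// -natrX -natrM ler_nat idx_le.
have h5 := ler_distD (V (dyad m (idx t m))) (V t) (V 0).
have h6 : 9 * C * decay ^+ m <= 9 * C by rewrite ler_piMr// mulr_ge0.
lra.
Qed.

End Chaining.

(** * Compact sets of paths *)

HB.instance Definition _ (T1 T2 : puniformType) := Uniform.on (T1 * T2)%type.

Section CompactPaths.
Context {R : realType} {N : nat} (lam : 'I_N -> R).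
Local Notation paths := {family compact, R -> (R * R)%type}.

(* The absolute value only makes [lnabs] continuous on the whole line: it is
   evaluated at nonnegative reals. *)
Definition lnabs (x : R) : R := ln (1 + `|x|).

Let lnabs_arg (x : R) : 0 < 1 + `|x|. Proof. by rewrite ltr_pwDl. Qed.

Lemma lnabs_continuous : continuous lnabs.
Proof.
move=> x; apply: (@continuous_comp _ _ _ (fun x : R => 1 + `|x|) (@ln R)).
  by apply: cvgD; [exact: cvg_cst|exact: norm_continuous].
by apply: continuous_ln.
Qed.

Lemma expR_lnabs x : 0 <= x -> expR (lnabs x) = 1 + x.
Proof. by move=> x0; rewrite lnK ?posrE// ger0_norm. Qed.

(** Brings a modulus of continuity of [ln (1 + q)] back to [q], at the price of a bound on the
    level. *)
Lemma dist_expR_le (B x y : R) : x <= B -> y <= B -> `|expR x - expR y| <= expR B * `|x - y|.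
Proof.
wlog xy : x y / y <= x.
  move=> H xB yB; have [xy|/ltW xy] := leP y x; first exact: H.
  by rewrite distrC (distrC x); exact: H.
move=> xB yB; rewrite !ger0_norm ?subr_ge0 ?ler_expR//.
have -> : expR x - expR y = expR x * (1 - expR (y - x)).
  by rewrite mulrBr mulr1 -expRD; congr (_ - expR _); ring.
apply: ler_pM; rewrite ?expR_ge0 ?ler_expR//.
  by rewrite subr_ge0 expR_le1 subr_le0.
by have := expR_ge1Dx (y - x); lra.
Qed.

Lemma max0_lipschitz (s t : R) : `|Num.max s 0 - Num.max t 0| <= `|s - t|.
Proof.
have h1 := ler_norm (s - t); have h2 := ler_norm (t - s).
rewrite (distrC t) in h2; rewrite ler_norml.
move: `|s - t| h1 h2 => z h1 h2.
by case: (leP s 0) => a; case: (leP t 0) => b; apply/andP; split; lra.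
Qed.

(** Beyond membership in [Cpaths], only countably many values of the path are constrained, by
    non-strict inequalities: this serves both closedness and measurability. *)
Definition tight_paths (M C : R) : set paths := [set g | Cpaths lam g /\
  [/\ lnabs (g 0).1 <= M, lnabs (g 0).2 <= M,
      chained C (fun t => lnabs (g t).1) & chained C (fun t => lnabs (g t).2)]].

Let hsdf : hausdorff_space (R * R)%type.
Proof. exact: norm_hausdorff. Qed.

Variables (M C : R).
Hypothesis C0 : 0 <= C.

Definition level_bound (m : nat) : R := M + C * (m%:R * 2 ^+ m + 9).

Section Component.
Variable h : R -> R.
Hypotheses (hc : continuous h) (h0 : forall t, t <= 0 -> h t = h 0)
  (hpos : forall t, 0 <= h t) (hM : lnabs (h 0) <= M)
  (hC : chained C (fun t => lnabs (h t))).

Let V t := lnabs (h t).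
Let Vc : continuous V.
Proof. by move=> t; apply: continuous_comp; [exact: hc|exact: lnabs_continuous]. Qed.

Let h_max t : h t = h (Num.max t 0).
Proof. by case: (leP t 0) => // /h0. Qed.

Lemma component_level (m : nat) t : t <= m%:R -> V (Num.max t 0) <= level_bound m.
Proof.
move=> tm.
have t0 : 0 <= Num.max t 0 by rewrite le_max lexx orbT.
have tm' : Num.max t 0 <= m%:R by rewrite ge_max tm ler0n.
have := chained_bound C0 Vc hC t0 tm'; rewrite ler_norml => /andP[_].
by rewrite /level_bound /V; move: hM; lra.
Qed.

Lemma component_le (m : nat) t : t <= m%:R -> h t <= expR (level_bound m).
Proof.
move=> /component_level; rewrite /V -h_max -ler_expR expR_lnabs//; lra.
Qed.

Lemma component_modulus (m j : nat) s t : s <= m%:R -> t <= m%:R -> (m <= j)%N ->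
  `|s - t| <= (2 ^+ j)^-1 ->
  `|h s - h t| <= expR (level_bound m) * (19 * C * decay ^+ j).
Proof.
move=> sm tm mj st.
have st' : `|Num.max s 0 - Num.max t 0| <= (2 ^+ j)^-1.
  apply: le_trans st.
  exact: max0_lipschitz.
have s0 : 0 <= Num.max s 0 by rewrite le_max lexx orbT.
have sm' : Num.max s 0 <= m%:R by rewrite ge_max sm ler0n.
have t0 : 0 <= Num.max t 0 by rewrite le_max lexx orbT.
have tm' : Num.max t 0 <= m%:R by rewrite ge_max tm ler0n.
have md := chained_modulus C0 Vc hC s0 sm' t0 tm' mj st'.
have := dist_expR_le (component_level sm) (component_level tm).
rewrite /V !expR_lnabs// -!h_max.
have -> : 1 + h s - (1 + h t) = h s - h t by ring.
move=> /le_trans; apply; rewrite ler_wpM2l ?expR_ge0//.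
by move: md; rewrite /V -!h_max.
Qed.

End Component.

Lemma tight_pathsP g : tight_paths M C g ->
  [/\ continuous (fun t => (g t).1) /\ continuous (fun t => (g t).2),
      forall t, t <= 0 -> (g t).1 = (g 0).1 /\ (g t).2 = (g 0).2 &
      forall t, 0 <= (g t).1 /\ 0 <= (g t).2].
Proof.
move=> [[gc [g0 gC]] _]; split.
- split=> t; (apply: (@continuous_comp _ _ _ (g : R -> R * R)); first exact: gc).
    exact: cvg_fst.
  exact: cvg_snd.
- by move=> t /g0 ->.
- by move=> t; have [a [b _]] := gC t; split => //; exact: le_trans b.
Qed.

Lemma tight_paths_pointwise_precompact :
  pointwise_precompact (tight_paths M C : set (R -> R * R)) id.
Proof.
move=> t; pose m := Num.truncn (Num.max t 0).
have tm : t <= m.+1%:R.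
  have t0 : 0 <= Num.max t 0 by rewrite le_max lexx orbT.
  by have /andP[_ h] := truncn_itv t0; apply: le_trans (ltW h); rewrite le_max lexx.
pose B := `[0, expR (level_bound m.+1)]%classic : set R.
have cB : compact (B `*` B) by apply: compact_setX; exact: segment_compact.
apply: (precompact_subset _ (compact_precompact hsdf cB)) => _ [g gK <-] /=.
have [[c1 c2] g0 gpos] := tight_pathsP gK; have [_ [M1 M2 C1 C2]] := gK.
have [p1 p2] := gpos t.
split; rewrite /B /= in_itv/= ?p1 ?p2 /=.
  apply: (component_le c1 _ _ M1 C1 tm); first by move=> u /g0[].
  by move=> u; have [] := gpos u.
apply: (component_le c2 _ _ M2 C2 tm); first by move=> u /g0[].
by move=> u; have [] := gpos u.
Qed.

Lemma tight_paths_equicontinuous :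
  equicontinuous (tight_paths M C : set (R -> R * R)) id.
Proof.
move=> t E; rewrite -entourage_ballE => -[e e0 eE].
(* One unit beyond the integer above [t], so that the horizon [m] also contains the points [u] near
   [t]. *)
pose m := (Num.truncn (Num.max t 0)).+2.
have tm : t + 1 <= m%:R.
  have t0 : 0 <= Num.max t 0 by rewrite le_max lexx orbT.
  have /andP[_ h] := truncn_itv t0.
  have : t <= Num.max t 0 by rewrite le_max lexx.
  by move: h; rewrite /m -!natr1; lra.
pose B := expR (level_bound m) * (19 * C).
have B0 : 0 <= B by rewrite mulr_ge0 ?expR_ge0// mulr_ge0.
have [j mj je] : exists2 j, (m <= j)%N & B * decay ^+ j < e.
  have d1 : `|decay : R| < 1 by rewrite ger0_norm /decay; lra.
  have e1 : 0 < e / (B + 1) by rewrite divr_gt0// ltr_wpDl.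
  have := cvg_expr d1 => /cvgr0Pnorm_lt/(_ _ e1) [j0 _ hj].
  exists (maxn m j0); first exact: leq_maxl.
  have := hj (maxn m j0) (leq_maxr _ _); rewrite /= ger0_norm ?exprn_ge0 ?decay_ge0//.
  rewrite ltr_pdivlMr ?ltr_wpDl//; apply: le_lt_trans.
  by rewrite mulrC ler_wpM2l ?exprn_ge0 ?decay_ge0// lerDl.
have p0 : 0 < (2 ^+ j)^-1 :> R by rewrite invr_gt0 exprn_gt0.
have p1 : (2 ^+ j)^-1 <= 1 :> R by rewrite invf_le1 ?exprn_gt0// exprn_ege1//; lra.
near=> u => g gK; apply: eE => /=.
have tu : `|t - u| <= (2 ^+ j)^-1.
  by near: u; exact: (@cvgr_dist_le _ _ _ _ _ id t _ _ p0).
have um : u <= m%:R by move: tu; rewrite ler_norml => /andP[]; lra.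
have tm' : t <= m%:R by lra.
have [[c1 c2] g0 gpos] := tight_pathsP gK; have [_ [M1 M2 C1 C2]] := gK.
split; rewrite /ball /=; apply: le_lt_trans je; rewrite /B -mulrA.
  apply: (component_modulus c1 _ _ M1 C1 tm' um mj tu); first by move=> v /g0[].
  by move=> v; have [] := gpos v.
apply: (component_modulus c2 _ _ M2 C2 tm' um mj tu); first by move=> v /g0[].
by move=> v; have [] := gpos v.
Unshelve. all: by end_near. Qed.

Lemma eval_continuous (t : R) : continuous (fun g : paths => (g : R -> R * R) t).
Proof.
move=> g E nE; have := @proj_continuous _ _ t g E nE.
exact: (@pointwise_cvg_compact_family _ _ (nbhs g)).
Qed.

Lemma closed_eval2 (s t : R) (F : set ((R * R) * (R * R))) : closed F ->
  closed [set g : paths | F ((g : R -> R * R) s, (g : R -> R * R) t)].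
Proof.
move=> cF; apply: (@closed_comp _ _ (fun g : paths => ((g : R -> R * R) s, (g : R -> R * R) t))) => // g _.
have ? : Filter (nbhs g) by exact: nbhs_filter.
exact: (cvg_pair (@eval_continuous s g) (@eval_continuous t g)).
Qed.

Lemma closed_le_fun (U : topologicalType) (f g : U -> R) :
  continuous f -> continuous g -> closed [set x | f x <= g x].
Proof.
move=> fc gc.
have -> : [set x | f x <= g x] = (fun x => g x - f x) @^-1` [set y | 0 <= y].
  by apply/seteqP; split => x /=; rewrite subr_ge0.
apply: closed_comp; last exact: closed_ge.
by move=> x _; apply: cvgB; [exact: gc|exact: fc].
Qed.

(** Every condition except continuity is an inequality between continuous functions of the values at
    two times, equalities being split in two. Continuity survives because, for an equicontinuous
    family, the compact-open closure is the pointwise one and is again equicontinuous. *)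
Lemma tight_paths_closed : closed (tight_paths M C).
Proof.
move=> g clg.
have sub (F : set paths) : closed F -> tight_paths M C `<=` F -> F g.
  by move=> cF sF; apply: cF; exact: closureS clg.
have f1 : continuous (fun p : (R * R) * (R * R) => p.1.1).
  by move=> p; apply: (@cvg_comp _ _ _ fst fst); exact: cvg_fst.
have f2 : continuous (fun p : (R * R) * (R * R) => p.1.2).
  by move=> p; apply: (@cvg_comp _ _ _ fst snd); [exact: cvg_fst|exact: cvg_snd].
have f3 : continuous (fun p : (R * R) * (R * R) => p.2.1).
  by move=> p; apply: (@cvg_comp _ _ _ snd fst); [exact: cvg_snd|exact: cvg_fst].
have f4 : continuous (fun p : (R * R) * (R * R) => p.2.2).
  by move=> p; apply: (@cvg_comp _ _ _ snd snd); exact: cvg_snd.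
have lc (f : (R * R) * (R * R) -> R) : continuous f -> continuous (fun p => lnabs (f p)).
  by move=> fc p; apply: continuous_comp; [exact: fc|exact: lnabs_continuous].
have nc (f f' : (R * R) * (R * R) -> R) : continuous f -> continuous f' ->
    continuous (fun p => `|f p - f' p|).
  move=> fc fc' p; apply: cvg_norm; apply: cvgB; [exact: fc|exact: fc'].
have cc (f : (R * R) * (R * R) -> R) : continuous f -> continuous (fun p => lamN lam * f p).
  by move=> fc p; apply: cvgM; [exact: cvg_cst|exact: fc].
have c0 (c : R) : continuous (fun _ : (R * R) * (R * R) => c).
  by move=> p; exact: cvg_cst.
have le (s t : R) (f f' : (R * R) * (R * R) -> R) : continuous f -> continuous f' ->
   (forall h, tight_paths M C h -> f (h s, h t) <= f' (h s, h t)) ->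
   f (g s, g t) <= f' (g s, g t).
  move=> fc fc' H; apply: (sub [set h | f (h s, h t) <= f' (h s, h t)]) => //.
  exact: (@closed_eval2 s t [set p | f p <= f' p] (closed_le_fun fc fc')).
split; first split.
- move: clg; rewrite (pointwise_compact_closure tight_paths_equicontinuous).
  move=> clg; apply: equicontinuous_continuous clg.
  exact: equicontinuous_closure tight_paths_equicontinuous.
- split=> t.
  + move=> t0; have E h : tight_paths M C h -> h t = h 0 by move=> [[_ [h0 _]] _]; exact: h0.
    apply: injective_projections; apply/eqP; rewrite eq_le; apply/andP; split.
    * by apply: (le t 0 _ _ f1 f3) => h /E ->.
    * by apply: (le t 0 _ _ f3 f1) => h /E ->.
    * by apply: (le t 0 _ _ f2 f4) => h /E ->.
    * by apply: (le t 0 _ _ f4 f2) => h /E ->.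
  + split; [|split].
    * by apply: (le t t _ _ (c0 0) f2) => h [[_ [_ /(_ t)[]]]].
    * by apply: (le t t _ _ f2 f1) => h [[_ [_ /(_ t)[_ []]]]].
    * by apply: (le t t _ _ f1 (cc _ f2)) => h [[_ [_ /(_ t)[_ []]]]].
- split.
  + by apply: (le 0 0 _ _ (lc _ f1) (c0 M)) => h [_ []].
  + by apply: (le 0 0 _ _ (lc _ f2) (c0 M)) => h [_ []].
  + move=> j k kj.
    by apply: (le _ _ _ _ (nc _ _ (lc _ f1) (lc _ f3)) (c0 _)) => h [_ [_ _ hC _]]; exact: hC.
  + move=> j k kj.
    by apply: (le _ _ _ _ (nc _ _ (lc _ f2) (lc _ f4)) (c0 _)) => h [_ [_ _ _ hC]]; exact: hC.
Qed.

Lemma tight_paths_compact : compact (tight_paths M C).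
Proof.
rewrite -(precompact_closed tight_paths_closed).
apply: (@pointwise_precompact_equicontinuous _ _ hsdf).
- exact: tight_paths_pointwise_precompact.
- exact: tight_paths_equicontinuous.
Qed.

End CompactPaths.

(** * Probability that a path fails to be chained *)

Section ChainTail.
Context {R : realType} d (T : measurableType d) (P : probability T R).

Lemma measure_bigcup_geometric (B : nat -> set T) (a rho : R) :
  0 <= rho < 1 -> (forall j, measurable (B j)) ->
  (forall j, fine (P (B j)) <= a * rho ^+ j) ->
  fine (P (\bigcup_j B j)) <= a / (1 - rho).
Proof.
move=> /andP[r0 r1] mB hB.
have a0 : 0 <= a by have := hB 0%N; rewrite expr0 mulr1; apply: le_trans; exact: fine_ge0.
have mU : measurable (\bigcup_j B j) by exact: bigcupT_measurable.
rewrite -lee_fin -prE//.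
apply: (@le_trans _ _ (\sum_(0 <= j <oo) P (B j))%E).
  exact: measure_sigma_subadditive.
apply: lime_le; first exact: is_cvg_nneseries.
near=> n; rewrite /=.
apply: (@le_trans _ _ (\sum_(0 <= j < n) (a * rho ^+ j)%:E)%E).
  by apply: lee_sum => j _; rewrite prE// lee_fin.
rewrite sumEFin lee_fin.
have d0 : 0 < 1 - rho by lra.
have := @geometric_seriesE _ a rho; rewrite lt_eqF// => /(_ isT)/(congr1 (fun u => u n)).
rewrite /series /= => ->; rewrite ler_pM2r ?invr_gt0// ler_piMr//.
by rewrite gerBl exprn_ge0.
Unshelve. all: by end_near. Qed.

(** Bernoulli's inequality trades the factor [j] for [20 * (21 / 20) ^+ j], and
    [2 * (10 / 9) ^ 4 * (21 / 20) / 4] is about [0.8], below [5 / 6]. *)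
Lemma geom_weight j : j%:R * 2 ^+ j * ((10 / 9) ^+ j) ^+ 4 / 4 ^+ j <= 20 * (5 / 6) ^+ j :> R.
Proof.
have bern : 1 + j%:R * (1 / 20) <= (21 / 20) ^+ j :> R.
  elim: j => [|j IH]; first by rewrite mul0r addr0 expr0.
  by rewrite exprS -natr1; have : 0 <= j%:R :> R by []; move: (j%:R : R) IH => y IH y0; nra.
have y0 : 0 <= 2 ^+ j * ((10 / 9) ^+ j) ^+ 4 / 4 ^+ j :> R.
  by rewrite !mulr_ge0 ?exprn_ge0 ?invr_ge0 ?exprn_ge0 ?divr_ge0.
have h : j%:R <= 20 * (21 / 20) ^+ j :> R by lra.
rewrite -2!mulrA (mulrA (2 ^+ j)).
apply: (le_trans (ler_wpM2r y0 h)); rewrite -[leLHS]mulrA ler_pM2l//.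
rewrite -exprM mulnC exprM -exprVn -!exprMn lerXn2r ?nnegrE//; lra.
Qed.

Context {N : nat} (X : R -> T -> 'rV[R]_N) (Xcont : cont_process X).
Variables (V : 'rV[R]_N -> R) (K C : R).
Hypothesis Vc : continuous V.
Hypothesis K0 : 0 <= K.
Hypothesis C2 : 2 <= C.
Hypothesis tail : forall r s t : R, 0 < r -> 0 <= s -> s <= t ->
  fine (P [set w | 2 * r < `|V (X t w) - V (X s w)|])
    <= K * (r^-1 + r^-1 ^+ 2) ^+ 2 * (t - s) ^+ 2.

Definition big_step j k : set T :=
  [set w | C * decay ^+ j < `|V (X (dyad j k.+1) w) - V (X (dyad j k) w)|].

Definition unchained : set T :=
  \bigcup_j \big[setU/set0]_(k < j * 2 ^ j) big_step j k.

Lemma measurable_big_step j k : measurable (big_step j k).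
Proof.
have mf : measurable_fun setT (fun w => `|V (X (dyad j k.+1) w) - V (X (dyad j k) w)|).
  by apply: measurableT_comp => //; apply: measurable_funB; exact: (measurable_obs Xcont _ Vc).
have := mf measurableT `]C * decay ^+ j, +oo[%classic (measurable_itv _).
by congr measurable; apply/seteqP; split => w /=; rewrite in_itv/= andbT => // -[].
Qed.

Lemma measurable_unchained : measurable unchained.
Proof.
by apply: bigcupT_measurable => j; apply: bigsetU_measurable => k _; exact: measurable_big_step.
Qed.

Lemma notin_unchained w : ~ unchained w -> chained C (fun t => V (X t w)).
Proof.
move=> nu j k kj; rewrite leNgt; apply/negP => h; apply: nu; exists j => //.
by rewrite -bigcup_mkord; exists k.
Qed.

(** [2 <= C] makes [2 / C] at most [1], so the mixed powers of [r^-1] collapse to one power of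
    [2 / C], enough for the tail to vanish as [C] grows. *)
Lemma big_step_tail j k :
  fine (P (big_step j k)) <= 4 * K * (2 / C) * (((10 / 9) ^+ j) ^+ 4 / 4 ^+ j).
Proof.
have C0 : 0 < C by exact: lt_le_trans C2.
have d0 : 0 < decay ^+ j :> R by rewrite exprn_gt0// /decay; lra.
have p0 : 0 < 2 ^+ j :> R by rewrite exprn_gt0.
pose r := C / 2 * decay ^+ j.
have r0 : 0 < r by rewrite mulr_gt0// divr_gt0.
have s0 : 0 <= dyad j k :> R by rewrite divr_ge0// ltW.
have ts : dyad j k.+1 - dyad j k = (2 ^+ j)^-1 :> R.
  by rewrite /dyad -natr1 mulrDl mul1r addrC addKr.
have st : dyad j k <= dyad j k.+1 :> R by rewrite -subr_ge0 ts invr_ge0 ltW.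
have := tail r0 s0 st; rewrite ts.
have -> : [set w | 2 * r < `|V (X (dyad j k.+1) w) - V (X (dyad j k) w)|] = big_step j k.
  have e : 2 * r = C * decay ^+ j by rewrite /r; field.
  by rewrite /big_step e.
move=> /le_trans; apply.
set y : R := (10 / 9) ^+ j.
have y1 : 1 <= y by rewrite exprn_ege1//; lra.
have ry : r^-1 = 2 / C * y.
  by rewrite /r !invfM invrK (mulrC C^-1) -exprVn /decay invf_div.
set a : R := 2 / C in ry *.
have a0 : 0 <= a by rewrite divr_ge0// ltW.
have a1 : a <= 1 by rewrite ler_pdivrMr// mul1r.
have q4 : (2 ^+ j)^-1 ^+ 2 = (4 ^+ j)^-1 :> R.
  by rewrite exprVn -exprM mulnC exprM -natrX.
have -> : 4 * K * a * (y ^+ 4 / 4 ^+ j) = K * (4 * (a * y ^+ 4)) * (4 ^+ j)^-1 by ring.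
rewrite q4 ler_pM2r ?invr_gt0 ?exprn_gt0// ler_wpM2l//.
have ay0 : 0 <= a * y by rewrite mulr_ge0//; lra.
have b1 : r^-1 + r^-1 ^+ 2 <= 2 * (a * y ^+ 2).
  rewrite ry.
  have e1 : a * y <= a * y ^+ 2 by rewrite ler_wpM2l//; nra.
  have e2 : (a * y) ^+ 2 <= a * y ^+ 2.
    by rewrite exprMn ler_wpM2r ?sqr_ge0// expr2 ler_piMr.
  lra.
have b0 : 0 <= r^-1 + r^-1 ^+ 2 by rewrite addr_ge0 ?sqr_ge0 ?invr_ge0 ?ltW.
apply: (@le_trans _ _ ((2 * (a * y ^+ 2)) ^+ 2)).
  by rewrite lerXn2r ?nnegrE// (le_trans b0).
have -> : (2 * (a * y ^+ 2)) ^+ 2 = 4 * (a * (a * y ^+ 4)) by ring.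
have ay : 0 <= a * y ^+ 4 by rewrite mulr_ge0// exprn_ge0//; lra.
by rewrite ler_pM2l// ler_piMl.
Qed.

(** [480 = 4 * 20 * 6]: the constants of [big_step_tail] and [geom_weight], and the sum of the
    geometric series of ratio [5 / 6]. *)
Lemma unchained_tail : fine (P unchained) <= 480 * K * (2 / C).
Proof.
have C0 : 0 < C by exact: lt_le_trans C2.
have a0 : 0 <= 2 / C by rewrite divr_ge0// ltW.
have -> : 480 * K * (2 / C) = (80 * K * (2 / C)) / (1 - 5 / 6) by field; rewrite gt_eqF.
apply: measure_bigcup_geometric; first by apply/andP; split; lra.
  by move=> j; apply: bigsetU_measurable => k _; exact: measurable_big_step.
move=> j.
have mU : measurable (\big[setU/set0]_(k < j * 2 ^ j) big_step j k).
  by apply: bigsetU_measurable => k _; exact: measurable_big_step.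
set z : R := ((10 / 9) ^+ j) ^+ 4 / 4 ^+ j.
apply: (@le_trans _ _ ((j * 2 ^ j)%:R * (4 * K * (2 / C) * z))).
  rewrite -lee_fin -prE//.
  apply: (@le_trans _ _ (\sum_(k < j * 2 ^ j) P (big_step j k))%E).
    by apply: (@content_subadditive _ _ _ P _ (big_step j)) => // k _; exact: measurable_big_step.
  apply: (@le_trans _ _ (\sum_(k < j * 2 ^ j) (4 * K * (2 / C) * z)%:E)%E).
    apply: lee_sum => k _; rewrite prE ?lee_fin; last exact: measurable_big_step.
    exact: big_step_tail.
  by rewrite sumEFin lee_fin sumr_const card_ord [leRHS]mulr_natl.
have h : j%:R * 2 ^+ j * z <= 20 * (5 / 6) ^+ j by rewrite /z mulrA; exact: geom_weight.
have -> : (j * 2 ^ j)%:R * (4 * K * (2 / C) * z) = 4 * K * (2 / C) * (j%:R * 2 ^+ j * z).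
  by rewrite natrM natrX; ring.
have -> : 80 * K * (2 / C) * (5 / 6) ^+ j = 4 * K * (2 / C) * (20 * (5 / 6) ^+ j) by ring.
by rewrite ler_wpM2l//; apply: mulr_ge0 => //; exact: mulr_ge0.
Qed.

End ChainTail.

(** * Tail bounds uniform in the parameter *)

Section RadialTails.
Context {R : realType} {N : nat} (a kappa al be : R) (lam delta : 'I_N -> R)
  (b : 'rV[R]_N -> 'rV[R]_N).
Hypothesis a_gt0 : 0 < a.
Hypothesis lam_ge1 : forall l, 1 <= lam l.
Hypothesis lam_pair : forall k l : 'I_N, k./2 = l./2 -> lam k = lam l.
Hypothesis deltaP : forall l, -1 < delta l <= 0.
Hypothesis b_ip : forall x, ip x (b x) = 0.
Hypothesis b_ipm1 : forall x, ipm1 lam x (b x) = 0.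
Hypotheses (al_ge0 : 0 <= al) (be_ge0 : 0 <= be).
Hypothesis albe_gt0 : 0 < al + be.
Context d (T : measurableType d) (X : R -> T -> 'rV[R]_N) (Xcont : cont_process X).

Local Notation V := (logw al be lam).

Let Vc : continuous V. Proof. exact: logw_continuous. Qed.

Let wt_ge0 l : 0 <= wt al be lam l. Proof. exact/ltW/wt_gt0. Qed.

(** [K] is chosen before [eps] and [P], which is the uniformity that tightness needs. The tail of
    [V] at time [0] follows from that of [q] because [ln (1 + q) <= q]. *)
Lemma radial_tails : exists K : R, 0 <= K /\
  forall eps (P : probability T R),
    solves_MP (gen a kappa eps lam delta b) X P -> stationary X P ->
    (forall r s t : R, 0 < r -> 0 <= s -> s <= t ->
      fine (P [set w | 2 * r < `|V (X t w) - V (X s w)|])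
        <= K * (r^-1 + r^-1 ^+ 2) ^+ 2 * (t - s) ^+ 2) /\
    (forall M, K <= M -> 0 < M -> fine (P [set w | M < V (X 0 w)]) <= K / M).
Proof.
have [D D0 HD] := bump_gen kappa a_gt0 lam_ge1 lam_pair deltaP b_ip b_ipm1 al_ge0 be_ge0 albe_gt0.
have [C C0 [m m0 HC]] :=
  confining_gen kappa a_gt0 lam_ge1 lam_pair deltaP b_ip b_ipm1 al_ge0 be_ge0 albe_gt0.
have i0 := incr_cst_ge0 D.
have c0 : 0 <= (C + 1) / m by apply: divr_ge0; [exact: addr_ge0|exact: ltW].
exists (incr_cst D + C + (C + 1) / m); split; first by rewrite !addr_ge0.
move=> eps P mp st; split=> [r s t r0 s0 st'|M KM M0].
  have V0 x : 0 <= V x by exact: logw_ge0.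
  apply: (le_trans (incr_tail Xcont mp Vc V0 D0 (HD eps) r0 s0 st')).
  by rewrite ler_wpM2r ?sqr_ge0// ler_wpM2r ?sqr_ge0// -addrA lerDl addr_ge0.
have qc : continuous (wsq (wt al be lam)).
  exact/elementary_continuous/elementary_wsq.
have CM : C <= M by move: KM i0 c0; lra.
have mq (g : 'rV[R]_N -> R) : continuous g -> measurable [set w | M < g (X 0 w)].
  move=> gc; have := @measurable_level _ _ _ _ _ Xcont g 0 `]M, +oo[%classic gc (measurable_itv _).
  by congr measurable; apply/seteqP; split => w /=; rewrite in_itv/= andbT.
apply: (@le_trans _ _ (fine (P [set w | M < wsq (wt al be lam) (X 0 w)]))).
  apply: pr_le; [exact: mq|exact: mq|move=> w /= /lt_le_trans; apply].
  by apply: le_ln1Dx; rewrite (lt_le_trans _ (wsq_ge0 wt_ge0 _))//; lra.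
apply: (le_trans (initial_tail Xcont mp qc m0 st (HC eps) CM M0)).
by rewrite invfM mulrA ler_pM2r ?invr_gt0// lerDr addr_ge0.
Qed.

End RadialTails.

(** * Tightness *)

Unset Implicit Arguments.

Theorem theorem4p1 (R : realType) (n : nat)
  (lam delta : 'I_(n.*2) -> R) (a kappa : R)
  (b : 'rV[R]_(n.*2) -> 'rV[R]_(n.*2))
  (d : measure_display) (T : measurableType d)
  (X : R -> T -> 'rV[R]_(n.*2)) (P : R -> probability T R) :
  (4 <= n)%N ->
  (forall k : 'I_(n.*2), k./2 = 0%N -> lam k = 1) ->
  (forall k l : 'I_(n.*2), k./2 = l./2 -> lam k = lam l) ->
  (forall k l : 'I_(n.*2), (k./2 < l./2)%N -> lam k < lam l) ->
  0 < a ->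
  (forall l, -1 < delta l <= 0) ->
  (forall k l : 'I_(n.*2), k./2 = l./2 -> delta k = delta l) ->
  (exists Q : 'I_(n.*2) -> 'I_(n.*2) -> 'I_(n.*2) -> R,
     forall x l, xco (b x) l =
       \sum_(j < n.*2) \sum_(k < n.*2) Q l j k * xco x j * xco x k) ->
  (forall x, \sum_(l < n.*2) pder l (fun y => xco (b y) l) x = 0) ->
  (forall x, ip x (b x) = 0) ->
  (forall x, ipm1 lam x (b x) = 0) ->
  0 < kappa <= 1 ->
  cont_process X ->
  (forall eps, 0 < eps ->
     solves_MP (gen a kappa eps lam delta b) X (P eps) /\ stationary X (P eps)) ->
  forall eta : R, 0 < eta ->
    exists K : set {family compact, R -> (R * R)%type},
      [/\ compact K, K `<=` Cpaths lam &
          forall eps, 0 < eps ->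
            measurable [set w | K (Wpath lam X w)] /\
            ((1 - eta)%:E <= P eps [set w | K (Wpath lam X w)])%E].
Proof.
move=> n4 lam1 lam_pair lam_lt a0 deltaP _ _ _ bip bipm1 _ Xc hP eta eta0.
have lam_ge1 l : 1 <= lam l.
  have i0 : (0 < n.*2)%N by rewrite double_gt0; apply: leq_trans n4.
  have [l0|l0] := posnP l./2; first by rewrite lam1.
  by rewrite -(lam1 (Ordinal i0))// ltW// lam_lt.
have lam_gt0 l : 0 < lam l by exact: lt_le_trans (lam_ge1 l).
pose q1 := wsq (wt 1 0 lam); pose q2 := wsq (wt 0 1 lam).
pose V1 := logw 1 0 lam; pose V2 := logw 0 1 lam.
have q1E x : sqn x = q1 x.
  by apply: eq_bigr => l _; rewrite /wt mul0r addr0 mul1r expr2.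
have q2E x : sqnm1 lam x = q2 x.
  by apply: eq_bigr => l _; rewrite /wt add0r mul1r expr2 mulrC.
have z1 : 0 <= 1 :> R by []. have z0 : 0 <= 0 :> R by [].
have z10 : 0 < 1 + 0 :> R by rewrite addr0. have z01 : 0 < 0 + 1 :> R by rewrite add0r.
have q10 x : 0 <= q1 x by apply: wsq_ge0 => l; apply/ltW/wt_gt0.
have q20 x : 0 <= q2 x by apply: wsq_ge0 => l; apply/ltW/wt_gt0.
have V1c : continuous V1 by exact: logw_continuous.
have V2c : continuous V2 by exact: logw_continuous.
have V1E t w : lnabs (Wpath lam X w t).1 = V1 (X (Num.max t 0) w).
  by rewrite /lnabs /Wpath /= q1E ger0_norm.
have V2E t w : lnabs (Wpath lam X w t).2 = V2 (X (Num.max t 0) w).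
  by rewrite /lnabs /Wpath /= q2E ger0_norm.
have [K1 [K10 H1]] := radial_tails kappa a0 lam_ge1 lam_pair deltaP bip bipm1 z1 z0 z10 Xc.
have [K2 [K20 H2]] := radial_tails kappa a0 lam_ge1 lam_pair deltaP bip bipm1 z0 z1 z01 Xc.
pose S := K1 + K2.
have S0 : 0 <= S by exact: addr_ge0.
(* [S + 1] here and [2] in [C] secure the side conditions [K1, K2 <= M], [0 < M] and [2 <= C]; the
   remaining summands push [S / M] and [960 * S / C] below [eta / 2]. *)
pose M := S + 1 + 4 * S / eta.
pose C := 2 + 3840 * S / eta.
have Se : 0 <= S / eta by rewrite divr_ge0// ltW.
have M0 : 0 < M by rewrite /M -mulrA; move: Se S0; lra.
have C2 : 2 <= C by rewrite /C -mulrA; move: Se; lra.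
have C0 : 0 < C by exact: lt_le_trans C2.
have WC w : Cpaths lam (Wpath lam X w).
  have Xcw : continuous (fun t : R => X (Num.max t 0) w) by exact: continuous_path.
  have q1c : continuous q1 by exact/elementary_continuous/elementary_wsq.
  have q2c : continuous q2 by exact/elementary_continuous/elementary_wsq.
  split; last split.
  - have -> : Wpath lam X w = (fun t : R => (q1 (X (Num.max t 0) w), q2 (X (Num.max t 0) w))).
      by apply/funext => t; rewrite /Wpath q1E q2E.
    have qX (q : 'rV[R]_(n.*2) -> R) : continuous q ->
        continuous (fun t : R => q (X (Num.max t 0) w)).
      by move=> qc t; apply: continuous_comp; [exact: Xcw|exact: qc].
    by move=> t; exact: (cvg_pair (qX _ q1c t) (qX _ q2c t)).
  - by move=> t t0; rewrite /Wpath (max_r t0) max_r.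
  (* The cone conditions hold term by term, from [1 <= lam l <= lamN lam]. *)
  - move=> t; rewrite /Wpath /Cset /=; set x := X _ _.
    split; first by rewrite q2E.
    split; rewrite ?mulr_sumr; apply: ler_sum => l _.
      by rewrite -[leRHS]mulr1 ler_wpM2l -?expr2 ?sqr_ge0// invf_le1.
    rewrite mulrCA -[leLHS]mulr1 ler_wpM2l -?expr2 ?sqr_ge0//.
    by rewrite ler_pdivlMr// mul1r /lamN; apply: le_bigmax.
pose U := (unchained X V1 C `|` unchained X V2 C) `|`
  ([set w | M < V1 (X 0 w)] `|` [set w | M < V2 (X 0 w)]).
pose G := [set w | tight_paths lam M C (Wpath lam X w)].
have mlev (V : 'rV[R]_(n.*2) -> R) : continuous V -> measurable [set w | M < V (X 0 w)].
  move=> Vc; have := @measurable_level _ _ _ _ _ Xc V 0 `]M, +oo[%classic Vc (measurable_itv _).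
  by congr measurable; apply/seteqP; split => w /=; rewrite in_itv/= andbT.
have dyad_ge0 j k : 0 <= dyad j k :> R by rewrite divr_ge0// exprn_ge0.
have chE (V : 'rV[R]_(n.*2) -> R) w :
    chained C (fun t => V (X (Num.max t 0) w)) <-> ~ unchained X V C w.
  split.
    move=> ch [j _]; rewrite -bigcup_mkord => -[k kj]; rewrite /big_step /=.
    by apply/negP; rewrite -leNgt; have := ch j k kj; rewrite !max_l.
  by move=> /notin_unchained ch j k kj; rewrite !max_l//; exact: ch.
(* Equality rather than inclusion, because the measurability of [G] is deduced from that of [U]. The
   times in [U] are nonnegative, so the constant extension of paths to negative times is
   harmless. *)
have GU : G = ~` U.
  apply/seteqP; split => w.
    move=> [_ [m1 m2 c1 c2]] [[|]|[|]] /=.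
    - by apply/(chE V1); move=> j k /c1; rewrite !V1E.
    - by apply/(chE V2); move=> j k /c2; rewrite !V2E.
    - by apply/negP; rewrite -leNgt; move: m1; rewrite V1E max_l.
    - by apply/negP; rewrite -leNgt; move: m2; rewrite V2E max_l.
  move=> nU; split; first exact: WC.
  split.
  - by rewrite V1E max_l// leNgt; apply/negP => h; apply: nU; right; left.
  - by rewrite V2E max_l// leNgt; apply/negP => h; apply: nU; right; right.
  - have /(chE V1) ch : ~ unchained X V1 C w by move=> h; apply: nU; left; left.
    by move=> j k /ch; rewrite !V1E.
  - have /(chE V2) ch : ~ unchained X V2 C w by move=> h; apply: nU; left; right.
    by move=> j k /ch; rewrite !V2E.
have mu1 : measurable (unchained X V1 C) by exact: measurable_unchained.
have mu2 : measurable (unchained X V2 C) by exact: measurable_unchained.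
have mU : measurable U.
  by apply: measurableU; apply: measurableU => //; exact: mlev.
have mG : measurable G by rewrite GU; exact: measurableC.
exists (tight_paths lam M C); split.
- by apply: tight_paths_compact; exact: ltW.
- by move=> g [].
move=> eps eps0; split => //; rewrite -/G.
have [mp st] := hP eps eps0.
have [t1 i1] := H1 eps (P eps) mp st; have [t2 i2] := H2 eps (P eps) mp st.
have u1 := unchained_tail Xc V1c K10 C2 t1; have u2 := unchained_tail Xc V2c K20 C2 t2.
have K1M : K1 <= M by rewrite /M /S -mulrA; move: Se K20; rewrite /S; lra.
have K2M : K2 <= M by rewrite /M /S -mulrA; move: Se K10; rewrite /S; lra.
have {}i1 := i1 M K1M M0; have {}i2 := i2 M K2M M0.
have prU (A B : set T) : measurable A -> measurable B ->
    fine (P eps (A `|` B)) <= fine (P eps A) + fine (P eps B).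
  move=> mA mB; rewrite -lee_fin EFinD -!prE//; last exact: measurableU.
  exact: measureU2.
have hU : fine (P eps U) <= eta.
  have h1 := prU _ _ mu1 mu2; have h2 := prU _ _ (mlev _ V1c) (mlev _ V2c).
  have h3 := prU _ _ (measurableU _ _ mu1 mu2) (measurableU _ _ (mlev _ V1c) (mlev _ V2c)).
  have e1 : 480 * K1 * (2 / C) + 480 * K2 * (2 / C) <= eta / 2.
    rewrite -mulrDl -mulrDr -/S mulrA ler_pdivrMr//.
    have -> : eta / 2 * C = eta + 1920 * S by rewrite /C; field; rewrite gt_eqF.
    by move: eta0 S0; lra.
  have e2 : K1 / M + K2 / M <= eta / 2.
    rewrite -mulrDl -/S ler_pdivrMr//.
    have -> : eta / 2 * M = eta / 2 * (S + 1) + 2 * S by rewrite /M; field; rewrite gt_eqF.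
    by have := mulr_ge0 (ltW eta0) S0; move: eta0 S0; lra.
  by rewrite /U; move: h1 h2 h3 u1 u2 i1 i2; lra.
rewrite GU probability_setC// prE// -EFinB lee_fin.
by move: hU; lra.
Qed.
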